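(* Let $C,D\subset\mathbb{R}^d$ be polyhedral cones with $\dim C=i$, $\dim D=j$, where $i+j=d-k<d$. Let $f:[0,1]\to\mathbb{R}$ be bounded and measurable. Then $$\int_{\mathrm{SO}_d}V_{d-k}(C+\vartheta D)\,f([C,\vartheta D])\,\nu(\mathrm{d}\vartheta)=c_{ij}(f)\,V_i(C)\,V_j(D).$$
   Context: Work in $\mathbb{R}^d$, $d\ge2$. $\nu$ is the Haar probability measure on $\mathrm{SO}_d$; $\gamma_L$ is the standard Gaussian measure on a linear subspace $L$, $\gamma_d=\gamma_{\mathbb{R}^d}$. A polyhedral cone is $\mathbb{R}^d$ or a finite intersection of closed halfspaces whose boundaries contain the origin; $\mathcal{F}_k(C)$ its set of $k$-faces, $L(F)$ the linear hull of $F$, $N(C,F)=\{y:\langle y,x\rangle\le0\ \forall x\in C,\ \langle y,x\rangle=0\ \forall x\in F\}$. Conic intrinsic volumes: $V_k(C)=\sum_{F\in\mathcal{F}_k(C)}\gamma_d(F+N(C,F))$ (zero if no $k$-faces); these do not depend on the ambient space, so for an $m$-dimensional cone $V_m(C)=\gamma_{L(C)}(C)$. Generalized sine: for linear subspaces $L_1,L_2$ with $\dim L_1+\dim L_2=m\le d$, $[L_1,L_2]$ is the $m$-dimensional volume of the parallelepiped spanned by the union of orthonormal bases of $L_1$ and $L_2$ (equal to $1$ if one subspace is $\{o\}$); if $\dim L_1+\dim L_2\ge d$, $[L_1,L_2]:=[L_1^\perp,L_2^\perp]$; $[C,D]:=[L(C),L(D)]$. For cones of dimensions $i,j$, $c_{ij}(f):=\int_{\mathrm{SO}_d}f([C,\vartheta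 D])\,\nu(\mathrm{d}\vartheta)$, which depends only on $i,j,f$. *)

(* Defs.v *)
From HB Require Import structures.
From mathcomp Require Import all_boot all_order all_algebra.
From mathcomp Require Import all_classical all_reals all_analysis.
Set Implicit Arguments. Unset Strict Implicit. Unset Printing Implicit Defensive.
Import Order.TTheory GRing.Theory Num.Theory.
Import numFieldNormedType.Exports.
Local Open Scope classical_set_scope.
Local Open Scope ring_scope.

Section ConicGeometry.
Variables (R : realType) (d : nat).
Local Notation vec := 'rV[R]_d.

Definition dotv (x y : vec) : R := \sum_(l < d) x ord0 l * y ord0 l.

Definition polyhedral_cone (C : set vec) : Prop :=
  exists (m : nat) (a : 'I_m -> vec), C = [set x | forall l, dotv (a l) x <= 0].

Definition lin_hull (S : set vec) : set vec :=
  [set x | exists (n : nat) (c : 'I_n -> R) (v : 'I_n -> vec),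
      (forall l, S (v l)) /\ x = \sum_(l < n) c l *: v l].

Definition perp (L : set vec) : set vec := [set y | forall x, L x -> dotv y x = 0].

Definition onb (L : set vec) (n : nat) (B : 'M[R]_(n, d)) : Prop :=
  B *m B^T = 1%:M /\ (forall x : vec, L x <-> (x <= B)%MS).

Definition dim_is (S : set vec) (n : nat) : Prop :=
  exists B : 'M[R]_(n, d), onb (lin_hull S) B.

(* faces of a (polyhedral) cone: intersections with supporting hyperplanes
   through o (y = 0 gives C itself) *)
Definition face (C F : set vec) : Prop :=
  exists y : vec, (forall x, C x -> dotv y x <= 0) /\
                  F = C `&` [set x | dotv y x = 0].

Definition kfaces (C : set vec) (k : nat) : set (set vec) :=
  [set F | face C F /\ dim_is F k].

Definition normal_cone (C F : set vec) : set vec :=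
  [set y | (forall x, C x -> dotv y x <= 0) /\ (forall x, F x -> dotv y x = 0)].

Definition minksum (A B : set vec) : set vec :=
  [set z | exists x y, A x /\ B y /\ z = x + y].

Definition gdens (t : R) : R := expR (- (t ^+ 2) / 2) / Num.sqrt (pi *+ 2).

Fixpoint gint (n : nat) : ('rV[R]_n -> \bar R) -> \bar R :=
  match n return ('rV[R]_n -> \bar R) -> \bar R with
  | 0 => fun h => h 0
  | n'.+1 => fun h =>
      (\int[@lebesgue_measure R]_(t in setT)
         ((gdens t)%:E * gint (fun y : 'rV[R]_n' => h (row_mx (\row_(_ < 1) t) y))))%E
  end.

Definition gauss (A : set vec) : \bar R := gint (fun x => (\1_A x)%:E).

Definition cvol (k : nat) (C : set vec) : \bar R :=
  (\esum_(F in kfaces C k) gauss (minksum F (normal_cone C F)))%E.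

(* m-dimensional volume of the parallelepiped spanned by the rows of M *)
Definition pvol (m : nat) (M : 'M[R]_(m, d)) : R := Num.sqrt (\det (M *m M^T)).

Definition gsine_low (L1 L2 : set vec) (s : R) : Prop :=
  exists (n1 n2 : nat) (B1 : 'M[R]_(n1, d)) (B2 : 'M[R]_(n2, d)),
    [/\ onb L1 B1, onb L2 B2, (n1 + n2 <= d)%N & s = pvol (col_mx B1 B2)].

Definition gsine (L1 L2 : set vec) : R :=
  xget 0 [set s | gsine_low L1 L2 s \/
    exists (n1 n2 : nat) (B1 : 'M[R]_(n1, d)) (B2 : 'M[R]_(n2, d)),
      [/\ onb L1 B1, onb L2 B2, (d <= n1 + n2)%N & gsine_low (perp L1) (perp L2) s]].

Definition gsineC (C D : set vec) : R := gsine (lin_hull C) (lin_hull D).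

(* rotated set: theta D = { theta x : x in D } (column convention) *)
Definition rot_set (th : 'M[R]_d) (D : set vec) : set vec :=
  (fun x => x *m th^T) @` D.

Definition is_SO (M : 'M[R]_d) : Prop := M *m M^T = 1%:M /\ \det M = 1.

(* rot is a Haar-distributed (uniform) random rotation on the probability
   space P: values in SO_d, Borel measurable, and its law is invariant under
   left multiplication by every element of SO_d (hence is the Haar
   probability measure nu). *)
Definition haar_rotation (dT : measure_display) (T : measurableType dT)
    (P : probability T R) (rot : T -> 'M[R]_d) : Prop :=
  [/\ (forall t, is_SO (rot t)),
      (forall h : 'M[R]_d -> R, continuous h -> measurable_fun setT (h \o rot)) &
      (forall g, is_SO g -> forall h : 'M[R]_d -> R, continuous h ->
         (\int[P]_t (h (g *m rot t))%:E = \int[P]_t (h (rot t))%:E)%E)].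

Definition coord_sub (n : nat) : set vec :=
  [set x | forall l : 'I_d, (n <= l)%N -> x ord0 l = 0].

(* c_ij(f) = int f([C, theta D]) nu(d theta) for cones of dims i, j;
   computed with the coordinate subspaces of dims i, j *)
Definition cij (dT : measure_display) (T : measurableType dT)
    (P : probability T R) (rot : T -> 'M[R]_d) (i j : nat) (f : R -> R) : \bar R :=
  (\int[P]_t (f (gsineC (coord_sub i) (rot_set (rot t) (coord_sub j))))%:E)%E.

End ConicGeometry.

(* Main.v *)
Require Import Defs.
From HB Require Import structures.
From mathcomp Require Import all_boot all_order all_algebra.
From mathcomp Require Import all_classical all_reals all_analysis.
From mathcomp Require Import measurable_realfun ring lra.
Set Implicit Arguments. Unset Strict Implicit. Unset Printing Implicit Defensive.
Import Order.TTheory GRing.Theory Num.Theory.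
Import numFieldNormedType.Exports.
Local Open Scope classical_set_scope.
Local Open Scope ring_scope.

(** For a generic rotation theta, L(C) + theta L(D) is a direct sum, and a point z
    lies in C + theta D + (L(C) + theta L(D))^perp exactly when the two components
    u(z) in L(C) and theta v(z) in theta L(D) of the orthogonal projection of z
    lie in C and theta D.  Hence, with a standard Gaussian z independent of
    theta, the left-hand side is the f([C, theta D])-weighted probability that
    u lies in C and v lies in D.  Multiplying theta on the left by a rotation
    preserving L(C), or on the right by one preserving L(D), and rotating z
    along, leaves the sine unchanged and rotates u, respectively v: the weighted
    law of (u, v) is invariant under O(L(C)) x O(L(D)).  A rotation-invariant law
    without mass at the origin gives a cone its Gaussian measure, so V_i(C) and
    V_j(D) factor out, one after the other. *)

(** * Borel structure on matrices *)

(** The hypothesis on [rot] gives left invariance only, tested on continuous functions; invariance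
    for measurable integrands and under right multiplication is derived from it. The averaging needs
    every orthogonal map of L(C) and of L(D), reflections included, while only SO_d is available: as
    i, j < d, a sign change orthogonal to the subspace repairs the determinant. So i + j < d serves
    twice, here and for the directness of the sum. The passage from invariance to Gaussian measure
    uses an auxiliary random orthogonal matrix of size n built from Gaussian vectors: its average
    turns the indicator of a cone into a constant off the origin, and integrating against the
    Gaussian identifies that constant. The vector z has to be rotated along because left
    multiplication alone would also disturb v. Coordinates of projections are computed with an
    adjugate in place of an inverse, hence only up to a positive factor, but as polynomials in theta
    and z. Fubini and invariance are used for nonnegative integrands, so a bounded f is written as
    (f + M) - M. *)

Section MatrixMeasurable.
Context {R : realType} {m n : nat}.

(** Generated by the entries, so that measurability into matrices is an entrywise matter;
    [measurable_cozero] links this sigma-algebra to the continuous test functions of the Haar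
    hypothesis. *)
Definition mx_cylinders : set (set 'M[R]_(m, n)) :=
  [set A | exists i j (B : set R),
     measurable B /\ A = (fun M : 'M[R]_(m, n) => M i j) @^-1` B].

Let mx0 : <<s mx_cylinders >> set0.
Proof. exact: sigma_algebra0. Qed.

Let mxC A : <<s mx_cylinders >> A -> <<s mx_cylinders >> (~` A).
Proof. exact: sigma_algebraC. Qed.

Let mxU (F : (set 'M[R]_(m, n))^nat) : (forall i, <<s mx_cylinders >> (F i)) ->
  <<s mx_cylinders >> (\bigcup_i F i).
Proof. exact: sigma_algebra_bigcup. Qed.

Definition mx_display : measure_display. Proof. exact. Qed.

HB.instance Definition _ := @isMeasurable.Build mx_display 'M[R]_(m, n)
  <<s mx_cylinders >> mx0 mxC mxU.

Lemma measurable_entry i j :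
  measurable_fun [set: 'M[R]_(m, n)] (fun M : 'M[R]_(m, n) => M i j).
Proof.
move=> _ B mB; rewrite setTI; apply: sub_sigma_algebra.
by exists i, j, B.
Qed.

Lemma measurable_mxP d (T : measurableType d) (f : T -> 'M[R]_(m, n)) :
  (forall i j, measurable_fun setT (fun t => f t i j)) -> measurable_fun setT f.
Proof.
move=> mf; apply: (@measurability _ _ _ _ _ _ mx_cylinders) => //.
move=> _ [_ [i [j [B [mB ->]]]] <-].
rewrite -comp_preimage; exact: (mf i j).
Qed.

Lemma measurable_entry_comp d (T : measurableType d) (f : T -> 'M[R]_(m, n)) i j :
  measurable_fun setT f -> measurable_fun setT (fun t => f t i j).
Proof. by move=> mf; exact: (measurableT_comp (measurable_entry i j) mf). Qed.

End MatrixMeasurable.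

Section MatrixMeasurableOps.
Context {R : realType} d (T : measurableType d).

Lemma measurable_mulmx m n p (f : T -> 'M[R]_(m, n)) (g : T -> 'M[R]_(n, p)) :
  measurable_fun setT f -> measurable_fun setT g ->
  measurable_fun setT (fun t => f t *m g t).
Proof.
move=> mf mg; apply: measurable_mxP => i j.
under eq_fun do rewrite mxE.
by apply: measurable_sum => k; apply: measurable_funM; exact: measurable_entry_comp.
Qed.

Lemma measurable_trmx m n (f : T -> 'M[R]_(m, n)) :
  measurable_fun setT f -> measurable_fun setT (fun t => (f t)^T).
Proof.
move=> mf; apply: measurable_mxP => i j.
by under eq_fun do rewrite mxE; exact: measurable_entry_comp.
Qed.

Lemma measurable_det n (f : T -> 'M[R]_n) :
  measurable_fun setT f -> measurable_fun setT (fun t => \det (f t)).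
Proof.
move=> mf; apply: measurable_sum => s; apply: measurable_funM => //.
by apply: measurable_prod => i _; exact: measurable_entry_comp.
Qed.

(** The adjugate stands in for an inverse later on: being polynomial in the entries, it is
    measurable with no case distinction for singular matrices. *)
Lemma measurable_adj n (f : T -> 'M[R]_n) :
  measurable_fun setT f -> measurable_fun setT (fun t => \adj (f t)).
Proof.
move=> mf; apply: measurable_mxP => i j.
under eq_fun do rewrite mxE.
apply: measurable_funM => //; apply: measurable_det; apply: measurable_mxP => k l.
by under eq_fun do rewrite !mxE; exact: measurable_entry_comp.
Qed.

Lemma measurable_row_mx m n p (f : T -> 'M[R]_(m, n)) (g : T -> 'M[R]_(m, p)) :
  measurable_fun setT f -> measurable_fun setT g ->
  measurable_fun setT (fun t => row_mx (f t) (g t)).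
Proof.
move=> mf mg; apply: measurable_mxP => i j.
under eq_fun do rewrite mxE.
by case: (fintype.split j) => k; exact: measurable_entry_comp.
Qed.

Lemma measurable_col_mx m n p (f : T -> 'M[R]_(m, n)) (g : T -> 'M[R]_(p, n)) :
  measurable_fun setT f -> measurable_fun setT g ->
  measurable_fun setT (fun t => col_mx (f t) (g t)).
Proof.
move=> mf mg; apply: measurable_mxP => i j.
under eq_fun do rewrite mxE.
by case: (fintype.split i) => k; exact: measurable_entry_comp.
Qed.

Lemma measurable_lsubmx m n p (f : T -> 'M[R]_(m, n + p)) :
  measurable_fun setT f -> measurable_fun setT (fun t => lsubmx (f t)).
Proof.
move=> mf; apply: measurable_mxP => i j.
by under eq_fun do rewrite mxE; exact: measurable_entry_comp.
Qed.

Lemma measurable_rsubmx m n p (f : T -> 'M[R]_(m, n + p)) :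
  measurable_fun setT f -> measurable_fun setT (fun t => rsubmx (f t)).
Proof.
move=> mf; apply: measurable_mxP => i j.
by under eq_fun do rewrite mxE; exact: measurable_entry_comp.
Qed.

Lemma measurable_addmx m n (f g : T -> 'M[R]_(m, n)) :
  measurable_fun setT f -> measurable_fun setT g ->
  measurable_fun setT (fun t => f t + g t).
Proof.
move=> mf mg; apply: measurable_mxP => i j; under eq_fun do rewrite mxE.
by apply: measurable_funD; exact: measurable_entry_comp.
Qed.

Lemma measurable_scalemx m n (a : T -> R) (f : T -> 'M[R]_(m, n)) :
  measurable_fun setT a -> measurable_fun setT f ->
  measurable_fun setT (fun t => a t *: f t).
Proof.
move=> ma mf; apply: measurable_mxP => i j; under eq_fun do rewrite mxE.
by apply: measurable_funM => //; exact: measurable_entry_comp.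
Qed.

Lemma measurable_dotv n (f g : T -> 'rV[R]_n) :
  measurable_fun setT f -> measurable_fun setT g ->
  measurable_fun setT (fun t => dotv (f t) (g t)).
Proof.
move=> mf mg; apply: measurable_sum => l.
by apply: measurable_funM; exact: measurable_entry_comp.
Qed.

Lemma measurable_sqrt (f : T -> R) :
  measurable_fun setT f -> measurable_fun setT (fun t => Num.sqrt (f t)).
Proof.
move=> mf; apply: (measurableT_comp _ mf); apply: continuous_measurable_fun.
exact: sqrt_continuous.
Qed.

End MatrixMeasurableOps.

(** * Rotation invariance of the Gaussian measure *)

Section DensityIntegral.
Local Open Scope ereal_scope.
Context d (T : measurableType d) (R : realType).
Variables (mu nu : {measure set T -> \bar R}) (g : T -> R).
Hypothesis mg : measurable_fun setT g.
Hypothesis g0 : forall x, (0 <= g x)%R.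
Hypothesis nuE : forall A, measurable A -> nu A = \int[mu]_(x in A) (g x)%:E.

Let integral_density_indic E : measurable E ->
  \int[nu]_x (\1_E x)%:E = \int[mu]_x ((\1_E x)%:E * (g x)%:E).
Proof.
move=> mE; rewrite integral_indic//= setIT nuE// integral_mkcond/=.
apply: eq_integral => x _; rewrite patchE indicE.
by case: (x \in E); rewrite ?mul1e ?mul0e.
Qed.

Import HBNNSimple.

Let integral_density_nnsfun (f : {nnsfun T >-> R}) :
  \int[nu]_x (f x)%:E = \int[mu]_x ((f x)%:E * (g x)%:E).
Proof.
under [LHS]eq_integral do rewrite fimfunE -fsumEFin//.
rewrite [LHS]ge0_integral_fsum//; last 2 first.
  - by move=> r; exact/measurable_EFinP/measurableT_comp.
  - by move=> n x _; rewrite EFinM nnfun_muleindic_ge0.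
under [RHS]eq_integral.
  move=> x xD; rewrite fimfunE -fsumEFin// ge0_mule_fsuml; last first.
    by move=> r; rewrite EFinM nnfun_muleindic_ge0.
  over.
rewrite [RHS]ge0_integral_fsum//; last 2 first.
  - move=> r; apply: emeasurable_funM; last exact/measurable_EFinP.
    by apply/measurable_EFinP; do 2 apply/measurableT_comp => //.
  - move=> n x _; rewrite EFinM mule_ge0//; first by rewrite nnfun_muleindic_ge0.
    by rewrite lee_fin.
apply: eq_fsbigr => r _.
have [r0|r0] := ltP r 0%R.
  rewrite !integral0_eq// => x _; rewrite (_ : f @^-1` [set r] = set0) ?indic0 ?mulr0 ?mul0e//;
  by rewrite -subset0 => y /= fyr; move: r0; rewrite -fyr ltNge fun_ge0.
under eq_integral do rewrite EFinM.
rewrite ge0_integralZl//; last exact/measurable_EFinP.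
rewrite integral_density_indic//.
under [in RHS]eq_integral do rewrite EFinM -muleA.
rewrite [RHS]ge0_integralZl//.
- by apply: emeasurable_funM; exact/measurable_EFinP.
- by move=> x _; rewrite mule_ge0 ?lee_fin.
Qed.

(** [nuE] concerns sets only; it passes to functions through simple functions and monotone
    convergence. *)
Lemma ge0_integral_density (f : T -> \bar R) :
  measurable_fun setT f -> (forall x, 0 <= f x) ->
  \int[nu]_x f x = \int[mu]_x (f x * (g x)%:E).
Proof.
move=> mf f0; pose f_ := nnsfun_approx measurableT mf.
transitivity (limn (fun n => \int[nu]_x (f_ n x)%:E)).
  rewrite -monotone_convergence//=.
  - apply: eq_integral => x _; apply/esym/cvg_lim => //=.
    exact: cvg_nnsfun_approx.
  - by move=> n; exact/measurable_EFinP/measurable_funTS.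
  - by move=> n x _; rewrite lee_fin.
  - by move=> x _ a b ab; rewrite lee_fin; exact/lefP/nd_nnsfun_approx.
transitivity (limn (fun n => \int[mu]_x ((f_ n x)%:E * (g x)%:E))).
  by apply: congr_lim; apply/funext => n /=; exact: integral_density_nnsfun.
rewrite -monotone_convergence//=.
- apply: eq_integral => x _; apply/cvg_lim => //=.
  by apply: cvgeZr => //; exact: cvg_nnsfun_approx.
- by move=> n; apply: emeasurable_funM; exact/measurable_EFinP.
- by move=> n x _; rewrite mule_ge0 ?lee_fin.
- move=> x _ a b ab; rewrite lee_wpmul2r ?lee_fin//.
  exact/lefP/nd_nnsfun_approx.
Qed.

End DensityIntegral.

Section GaussLine.
Context {R : realType}.
Local Notation mu := (@lebesgue_measure R).
Local Notation N := (normal_prob (0 : R) 1).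
Local Open Scope ereal_scope.

Lemma gdens_ge0 (t : R) : (0 <= gdens t)%R.
Proof. by rewrite /gdens divr_ge0 ?expR_ge0 ?sqrtr_ge0. Qed.

Lemma gdensE : @gdens R = normal_pdf 0 1.
Proof.
apply/funext => t; rewrite normal_pdfE ?oner_neq0// /gdens /normal_peak /normal_fun.
by rewrite subr0 expr1n mul1r mulrC.
Qed.

Lemma measurable_gdens : measurable_fun setT (@gdens R).
Proof. by rewrite gdensE; exact: measurable_normal_pdf. Qed.

Lemma integral_normal (f : R -> \bar R) :
  measurable_fun setT f -> (forall x, 0 <= f x) ->
  \int[N]_x f x = \int[mu]_x (f x * (gdens x)%:E).
Proof.
move=> mf f0; apply: ge0_integral_density => //; first exact: measurable_gdens.
  exact: gdens_ge0.
by move=> A mA; rewrite gdensE.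
Qed.

Lemma ge0_integral_shift (f : R -> \bar R) (a : R) :
  measurable_fun setT f -> (forall x, 0 <= f x) ->
  \int[mu]_x f (x + a)%R = \int[mu]_x f x.
Proof.
move=> mf f0.
pose s (x : measurableTypeR R) : measurableTypeR R := (x + a)%R.
have ms : measurable_fun setT s by exact: measurable_funD.
transitivity (\int[pushforward mu s]_x f x); first by rewrite ge0_integral_pushforward.
apply: eq_measure_integral => A mA _; apply/esym.
apply: lebesgue_measure_unique => // _ [[b c] _ <-].
rewrite /= /pushforward (_ : s @^-1` _ = `](b - a)%R, (c - a)%R]%classic).
  by rewrite /= !lebesgue_measure_itv/= !lte_fin ltrD2r -!EFinB opprB addrA subrK.
by apply/seteqP; split=> x /=; rewrite !in_itv/= /s ltrBlDr lerBrDr.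
Qed.

Lemma ge0_integral_opp (f : R -> \bar R) :
  measurable_fun setT f -> (forall x, 0 <= f x) ->
  \int[mu]_x f (- x)%R = \int[mu]_x f x.
Proof.
move=> mf f0.
transitivity (\int[pushforward mu (-%R : _ -> measurableTypeR R)]_x f x).
  by rewrite ge0_integral_pushforward.
by apply: eq_measure_integral => A mA _; exact: lebesgue_measureN.
Qed.

End GaussLine.

(** * Rotations of the plane and the two-dimensional Gaussian *)

Section PlaneRotation.
Context {R : realType}.
Local Notation mu := (@lebesgue_measure R).
Local Notation N := (normal_prob (0 : R) 1).
Local Open Scope ereal_scope.
Implicit Types k : R * R -> \bar R.

Lemma integral_shear1 k (a : R) :
  measurable_fun setT k -> (forall z, 0 <= k z) ->
  \int[mu]_x \int[mu]_y k ((x + a * y)%R, y) = \int[mu]_x \int[mu]_y k (x, y).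
Proof.
move=> mk k0.
have mk' : measurable_fun setT (fun z : R * R => k ((z.1 + a * z.2)%R, z.2)).
  apply: (measurableT_comp mk); apply/measurable_fun_pair => //.
  by apply: measurable_funD => //; apply: measurable_funM.
transitivity (\int[mu]_y \int[mu]_x k ((x + a * y)%R, y)).
  exact: (fubini_tonelli (m1 := mu) (m2 := mu) _ mk').
transitivity (\int[mu]_y \int[mu]_x k (x, y)); last first.
  exact/esym/(fubini_tonelli (m1 := mu) (m2 := mu) _ mk).
apply: eq_integral => y _; rewrite (ge0_integral_shift (f := fun x => k (x, y)))//.
exact: measurableT_comp.
Qed.

Lemma integral_shear2 k (a : R) :
  measurable_fun setT k -> (forall z, 0 <= k z) ->
  \int[mu]_x \int[mu]_y k (x, (y + a * x)%R) = \int[mu]_x \int[mu]_y k (x, y).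
Proof.
move=> mk k0; apply: eq_integral => x _.
rewrite (ge0_integral_shift (f := fun y => k (x, y)))//.
exact: measurableT_comp.
Qed.

(* A rotation other than the half-turn is a product of three shears. *)
Lemma integral_rotation k (c s : R) :
  measurable_fun setT k -> (forall z, 0 <= k z) ->
  s != 0%R -> (c ^+ 2 + s ^+ 2 = 1)%R ->
  \int[mu]_x \int[mu]_y k ((c * x - s * y)%R, (s * x + c * y)%R) =
  \int[mu]_x \int[mu]_y k (x, y).
Proof.
(* With c = cos t and s = sin t, [a] is -tan(t/2); the three shears have coefficients [a], [s],
   [a]. *)
move=> mk k0 s0 cs; pose a := ((c - 1) / s)%R.
have sh1 (h : R * R -> \bar R) : measurable_fun setT h ->
    measurable_fun setT (fun z : R * R => h ((z.1 + a * z.2)%R, z.2)).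
  move=> mh; apply: (measurableT_comp mh); apply/measurable_fun_pair => //.
  by apply: measurable_funD => //; apply: measurable_funM.
have sh2 (h : R * R -> \bar R) : measurable_fun setT h ->
    measurable_fun setT (fun z : R * R => h (z.1, (z.2 + s * z.1)%R)).
  move=> mh; apply: (measurableT_comp mh); apply/measurable_fun_pair => //.
  by apply: measurable_funD => //; apply: measurable_funM.
pose k1 (z : R * R) := k ((z.1 + a * z.2)%R, z.2).
pose k2 (z : R * R) := k1 (z.1, (z.2 + s * z.1)%R).
have e1 : \int[mu]_x \int[mu]_y k1 (x, y) = \int[mu]_x \int[mu]_y k (x, y).
  exact: (integral_shear1 a mk k0).
have e2 : \int[mu]_x \int[mu]_y k2 (x, y) = \int[mu]_x \int[mu]_y k1 (x, y).
  exact: (@integral_shear2 k1 s (sh1 _ mk) (fun=> k0 _)).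
have e3 : \int[mu]_x \int[mu]_y k2 ((x + a * y)%R, y) = \int[mu]_x \int[mu]_y k2 (x, y).
  exact: (@integral_shear1 k2 a (sh2 _ (sh1 _ mk)) (fun=> k0 _)).
rewrite -e1 -e2 -e3; rewrite /k2 /k1 /=.
apply: eq_integral => x _; apply: eq_integral => y _ /=.
have as1 : (a * s = c - 1)%R by rewrite /a divfK.
have c1 : (c = 1 + a * s)%R by rewrite as1 addrC subrK.
have s1 : (- s = 2 * a + a ^+ 2 * s)%R.
  apply: (mulIf s0); rewrite [RHS](_ : _ = 2 * (a * s) + (a * s) ^+ 2)%R; last by ring.
  by rewrite as1; lra.
congr k; congr pair.
  rewrite -mulNr s1 c1; ring.
rewrite c1; ring.
Qed.

Lemma integral_normal2 k :
  measurable_fun setT k -> (forall z, 0 <= k z) ->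
  \int[N]_x \int[N]_y k (x, y) =
  \int[mu]_x \int[mu]_y (k (x, y) * (gdens x * gdens y)%:E).
Proof.
move=> mk k0; rewrite integral_normal//; last 2 first.
- exact: (measurable_fun_fubini_tonelli_F (m2 := N) k).
- by move=> x; exact: integral_ge0.
apply: eq_integral => x _; rewrite integral_normal//; last exact: measurableT_comp.
rewrite -ge0_integralZr//.
- by apply: eq_integral => y _; rewrite -muleA -EFinM (mulrC (gdens y)).
- apply: emeasurable_funM; first exact: measurableT_comp.
  by apply/measurable_EFinP; exact: measurable_gdens.
- by move=> y _; rewrite mule_ge0 ?lee_fin ?gdens_ge0.
- by rewrite lee_fin gdens_ge0.
Qed.

Lemma gdensM (x y : R) : (gdens x * gdens y =
  expR (- (x ^+ 2 + y ^+ 2) / 2) / (Num.sqrt (pi *+ 2) * Num.sqrt (pi *+ 2)))%R.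
Proof. by rewrite /gdens mulf_div -expRD -mulrDl -opprD. Qed.

Lemma integral_normal_rotation k (c s : R) :
  measurable_fun setT k -> (forall z, 0 <= k z) ->
  s != 0%R -> (c ^+ 2 + s ^+ 2 = 1)%R ->
  \int[N]_x \int[N]_y k ((c * x - s * y)%R, (s * x + c * y)%R) =
  \int[N]_x \int[N]_y k (x, y).
Proof.
move=> mk k0 s0 cs.
have mrot : measurable_fun setT
    (fun z : R * R => ((c * z.1 - s * z.2)%R, (s * z.1 + c * z.2)%R)).
  by apply/measurable_fun_pair; [apply: measurable_funB|apply: measurable_funD];
    exact: measurable_funM.
rewrite (integral_normal2 (measurableT_comp mk mrot) (fun=> k0 _)).
rewrite (integral_normal2 mk k0).
pose kg (z : R * R) := k z * (gdens z.1 * gdens z.2)%:E.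
have mkg : measurable_fun setT kg.
  apply: emeasurable_funM => //; apply/measurable_EFinP; apply: measurable_funM.
    by apply: (measurableT_comp measurable_gdens).
  by apply: (measurableT_comp measurable_gdens).
have kg0 z : 0 <= kg z by rewrite mule_ge0 ?lee_fin ?mulr_ge0 ?gdens_ge0.
rewrite -[RHS](integral_rotation mkg kg0 s0 cs) /kg/=.
apply: eq_integral => x _; apply: eq_integral => y _; congr (_ * _%:E).
rewrite !gdensM; congr (expR (- _ / 2) / _)%R.
by rewrite -[LHS]mul1r -cs; ring.
Qed.

Lemma integral_normal_opp (f : R -> \bar R) :
  measurable_fun setT f -> (forall x, 0 <= f x) ->
  \int[N]_x f (- x)%R = \int[N]_x f x.
Proof.
move=> mf f0; rewrite (integral_normal mf f0) (integral_normal (f := fun x => f (- x)%R))//; last first.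
  by apply: (measurableT_comp mf); exact: oppr_measurable.
rewrite -(ge0_integral_opp (f := fun x => f x * (gdens x)%:E)).
- by apply: eq_integral => x _; rewrite /gdens sqrrN.
- by apply: emeasurable_funM => //; apply/measurable_EFinP; exact: measurable_gdens.
- by move=> x; rewrite mule_ge0 ?lee_fin ?gdens_ge0.
Qed.

End PlaneRotation.

(** * The standard Gaussian as a probability measure *)

Section GaussMeasure.
Context {R : realType}.
Local Notation N := (normal_prob (0 : R) 1).
Local Open Scope ereal_scope.

Definition cons_row n (p : measurableTypeR R * 'rV[R]_n) : 'rV[R]_(1 + n) :=
  row_mx (\row_(_ < 1) p.1) p.2.

Lemma measurable_cons_row n : measurable_fun setT (@cons_row n).
Proof.
apply: measurable_row_mx => //; apply: measurable_mxP => i j.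
by under eq_fun do rewrite mxE; exact: measurable_fst.
Qed.

HB.instance Definition _ n :=
  @isMeasurableFun.Build _ _ _ _ (@cons_row n) (@measurable_cons_row n).

Definition gauss_cons n (P : probability 'rV[R]_n R) : probability 'rV[R]_n.+1 R :=
  distribution (N \x P : probability _ R) (@cons_row n).

(** [gint] is an iterated integral with no measure behind it. Its recursion is repeated here with
    product measures, which makes Fubini and null sets available; [gint_integral] identifies the
    two. *)
Fixpoint gaussm n : probability 'rV[R]_n R :=
  match n with
  | 0 => \d_(0%R : 'rV[R]_0)
  | n'.+1 => gauss_cons (gaussm n')
  end.

Lemma integral_gaussmS n (h : 'rV[R]_n.+1 -> \bar R) :
  measurable_fun setT h -> (forall x, 0 <= h x) ->
  \int[gaussm n.+1]_x h x =
  \int[N]_t \int[gaussm n]_y h (row_mx (\row_(_ < 1) t) y).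
Proof.
move=> mh h0; rewrite ge0_integral_distribution// fubini_tonelli1//=.
exact: (measurableT_comp mh (@measurable_cons_row n)).
Qed.

Lemma gint_integral n (h : 'rV[R]_n -> \bar R) :
  measurable_fun setT h -> (forall x, 0 <= h x) ->
  gint h = \int[gaussm n]_x h x.
Proof.
elim: n h => [|n IH] h mh h0 /=.
  by rewrite integral_dirac// diracT mul1e.
have mc := measurableT_comp mh (@measurable_cons_row n).
rewrite [RHS]integral_gaussmS//.
have mi : measurable_fun setT
    (fun t : R => \int[gaussm n]_y h (row_mx (\row_(_ < 1) t) y)).
  exact: (measurable_fun_fubini_tonelli_F (m2 := gaussm n) _ mc (fun=> h0 _)).
rewrite (integral_normal mi); last by move=> t; exact: integral_ge0.
apply: eq_integral => t _; rewrite muleC IH//.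
exact: (measurable_fun_pair2 _ mc).
Qed.

Lemma gaussE n (A : set 'rV[R]_n) : measurable A -> gauss A = gaussm n A.
Proof.
move=> mA; rewrite /gauss gint_integral//.
  by rewrite integral_indic// setIT.
exact/measurable_EFinP/measurable_indic.
Qed.

End GaussMeasure.

(** * Orthogonal matrices and reflections *)

Section Orthogonal.
Context {R : realType}.

(** The determinant is left free, so that the reflections [hh] qualify. *)
Definition orth n (O : 'M[R]_n) : Prop := O *m O^T = 1%:M.

Lemma orthT n (O : 'M[R]_n) : orth O -> orth O^T.
Proof. by rewrite /orth trmxK => /mulmx1C. Qed.

Lemma orth1 n : orth (1%:M : 'M[R]_n).
Proof. by rewrite /orth trmx1 mulmx1. Qed.

Lemma orthM n (O1 O2 : 'M[R]_n) : orth O1 -> orth O2 -> orth (O1 *m O2).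
Proof. by move=> h1 h2; rewrite /orth trmx_mul mulmxA -(mulmxA O1) h2 mulmx1. Qed.

Lemma orth_block m n (O1 : 'M[R]_m) (O2 : 'M[R]_n) :
  orth O1 -> orth O2 -> orth (block_mx O1 0 0 O2).
Proof.
move=> h1 h2; rewrite /orth tr_block_mx mulmx_block !trmx0 !mulmx0 !mul0mx.
by rewrite !addr0 !add0r h1 h2 -scalar_mx_block.
Qed.

Lemma dotvE n (x y : 'rV[R]_n) : dotv x y = (x *m y^T) 0 0.
Proof. by rewrite mxE; apply: eq_bigr => l _; rewrite mxE. Qed.

Lemma mulmx_dotv n (x y : 'rV[R]_n) : x *m y^T = (dotv x y)%:M.
Proof. by rewrite [LHS]mx11_scalar dotvE. Qed.

Lemma dotvC n (x y : 'rV[R]_n) : dotv x y = dotv y x.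
Proof. by apply: eq_bigr => l _; rewrite mulrC. Qed.

Lemma dotvDl n (x y z : 'rV[R]_n) : dotv (x + y) z = dotv x z + dotv y z.
Proof. by rewrite !dotvE mulmxDl mxE. Qed.

Lemma dotvZl n a (x z : 'rV[R]_n) : dotv (a *: x) z = a * dotv x z.
Proof. by rewrite !dotvE -scalemxAl mxE. Qed.

Lemma dotvNl n (x z : 'rV[R]_n) : dotv (- x) z = - dotv x z.
Proof. by rewrite -scaleN1r dotvZl mulN1r. Qed.

Lemma dotvDr n (x y z : 'rV[R]_n) : dotv z (x + y) = dotv z x + dotv z y.
Proof. by rewrite dotvC dotvDl !(dotvC z). Qed.

Lemma dotvZr n a (x z : 'rV[R]_n) : dotv z (a *: x) = a * dotv z x.
Proof. by rewrite dotvC dotvZl dotvC. Qed.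

Lemma dotvNr n (x z : 'rV[R]_n) : dotv z (- x) = - dotv z x.
Proof. by rewrite dotvC dotvNl dotvC. Qed.

Lemma dot0v n (x : 'rV[R]_n) : dotv 0 x = 0.
Proof. by rewrite dotvE mul0mx mxE. Qed.

Lemma dotv0 n (x : 'rV[R]_n) : dotv x 0 = 0.
Proof. by rewrite dotvC dot0v. Qed.

Lemma dotvv_ge0 n (x : 'rV[R]_n) : 0 <= dotv x x.
Proof. by apply: sumr_ge0 => l _; rewrite -expr2 sqr_ge0. Qed.

Lemma dotvv_eq0 n (x : 'rV[R]_n) : (dotv x x == 0) = (x == 0).
Proof.
apply/eqP/eqP => [|->]; last exact: dot0v.
move/eqP; rewrite psumr_eq0 => [/allP h|l _]; last by rewrite -expr2 sqr_ge0.
apply/rowP => l; rewrite mxE; have := h l (mem_index_enum l).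
by rewrite -expr2 sqrf_eq0 => /eqP.
Qed.

Lemma dotv_mulmx m n (x : 'rV[R]_m) (y : 'rV[R]_n) (A : 'M[R]_(m, n)) :
  dotv (x *m A) y = dotv x (y *m A^T).
Proof. by rewrite !dotvE trmx_mul trmxK mulmxA. Qed.

Lemma dotv_orth n (x y : 'rV[R]_n) O : orth O -> dotv (x *m O) (y *m O) = dotv x y.
Proof. by move=> h; rewrite dotv_mulmx -mulmxA h mulmx1. Qed.

Lemma dotv_row m n (a b : 'rV[R]_m) (x y : 'rV[R]_n) :
  dotv (row_mx a x) (row_mx b y) = dotv a b + dotv x y.
Proof. by rewrite !dotvE tr_row_mx mul_row_col mxE. Qed.

Lemma dotv_scalar (a b : R) : dotv (a%:M : 'rV[R]_1) b%:M = a * b.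
Proof. by rewrite /dotv big_ord1 !mxE eqxx !mulr1n. Qed.

(* The reflection exchanging x and y when they have the same norm; for x = y
   the division by zero yields the identity. *)
Definition hh n (x y : 'rV[R]_n) : 'M[R]_n :=
  1%:M - (2 / dotv (x - y) (x - y)) *: ((x - y)^T *m (x - y)).

Lemma hh_orth n (x y : 'rV[R]_n) : orth (hh x y).
Proof.
rewrite /orth /hh; set v := x - y; set q := dotv v v; set P := v^T *m v.
have PT : P^T = P by rewrite trmx_mul trmxK.
have PP : P *m P = q *: P.
  by rewrite /P -mulmxA (mulmxA v) mulmx_dotv mul_scalar_mx -scalemxAr.
clearbody P; rewrite linearB/= trmx1 [(_ *: P)^T]linearZ/= PT.
rewrite mulmxBl mul1mx mulmxBr mulmx1 -!scalemxAl -!scalemxAr PP.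
have [q0|q0] := eqVneq q 0; first by rewrite q0 invr0 mulr0 !scale0r !subr0.
rewrite !scalerA mulrA divfK// opprB -addrA addrCA -scaleNr -!scalerDl.
rewrite addrCA -scalerDl (_ : _ + _ = 0 :> R) ?scale0r ?addr0//.
by ring.
Qed.

Lemma hhE n (x y : 'rV[R]_n) : dotv x x = dotv y y -> x *m hh x y = y.
Proof.
move=> xy; rewrite /hh mulmxBr mulmx1 -scalemxAr mulmxA mulmx_dotv mul_scalar_mx.
have [v0|v0] := eqVneq (x - y) 0.
  by rewrite v0 !scaler0 subr0; exact: subr0_eq.
have q0 : dotv (x - y) (x - y) != 0 by rewrite dotvv_eq0.
(* Equal norms give |x - y|^2 = 2 <x, x - y>, so the coefficient of x - y is 1. *)
rewrite scalerA (_ : _ * _ = 1) ?scale1r ?subKr//.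
rewrite mulrAC; apply: (mulIf q0); rewrite divfK// mul1r.
by rewrite !(dotvDl, dotvDr, dotvNl, dotvNr) -xy (dotvC y x); ring.
Qed.

End Orthogonal.

Section GaussInvariance.
Context {R : realType}.
Local Notation N := (normal_prob (0 : R) 1).
Local Open Scope ereal_scope.

Definition gauss_inv n (O : 'M[R]_n) : Prop := forall h : 'rV[R]_n -> \bar R,
  measurable_fun setT h -> (forall x, 0 <= h x) ->
  \int[gaussm n]_x h (x *m O) = \int[gaussm n]_x h x.

Lemma measurable_mulmxr m n p (A : 'M[R]_(n, p)) :
  measurable_fun setT (fun x : 'M[R]_(m, n) => x *m A).
Proof. exact: measurable_mulmx. Qed.

Lemma measurable_fun_mulmxr m n (A : 'M[R]_(m, n)) (h : 'rV[R]_n -> \bar R) :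
  measurable_fun setT h -> measurable_fun setT (fun x => h (x *m A)).
Proof. by move=> mh; exact: (measurableT_comp mh (measurable_mulmxr _)). Qed.

Lemma gauss_invM n (O1 O2 : 'M[R]_n) :
  gauss_inv O1 -> gauss_inv O2 -> gauss_inv (O1 *m O2).
Proof.
move=> i1 i2 h mh h0; rewrite -[RHS]i2// -[RHS]i1//; last exact: measurable_fun_mulmxr.
by apply: eq_integral => x _; rewrite mulmxA.
Qed.

Lemma gauss_inv1 n : gauss_inv (1%:M : 'M[R]_n).
Proof. by move=> h mh h0; apply: eq_integral => x _; rewrite mulmx1. Qed.

Lemma gauss_invT n (O : 'M[R]_n) : orth O -> gauss_inv O -> gauss_inv O^T.
Proof.
move=> oO iO h mh h0; rewrite -[LHS]iO//; last exact: measurable_fun_mulmxr.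
by apply: eq_integral => x _; rewrite -mulmxA oO mulmx1.
Qed.

Lemma measurable_cons_fun n (h : 'rV[R]_n.+1 -> \bar R) :
  measurable_fun setT h ->
  measurable_fun setT (fun p : R * 'rV[R]_n => h (row_mx (\row_(_ < 1) p.1) p.2)).
Proof. by move=> mh; exact: (measurableT_comp mh (@measurable_cons_row R n)). Qed.

Lemma gauss_inv_block n (O : 'M[R]_n) :
  gauss_inv O -> gauss_inv (block_mx 1%:M 0 0 O : 'M[R]_(1 + n)).
Proof.
move=> iO h mh h0.
rewrite integral_gaussmS//; last exact: (measurable_fun_mulmxr (m := 1 + n)).
rewrite (integral_gaussmS mh h0); apply: eq_integral => t _.
rewrite -[RHS]iO//; last exact: (measurable_fun_pair2 _ (measurable_cons_fun mh)).
apply: eq_integral => y _.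
by rewrite (mul_row_block (n1 := 1)) !mulmx0 addr0 add0r mulmx1.
Qed.

(** Serves [gauss_orth] when the first row is already minus the first basis vector: a plane rotation
    would then be a half-turn, which the shear argument excludes. *)
Lemma gauss_inv_opp n : gauss_inv (block_mx (- 1%:M) 0 0 1%:M : 'M[R]_(1 + n)).
Proof.
move=> h mh h0.
rewrite integral_gaussmS//; last exact: (measurable_fun_mulmxr (m := 1 + n)).
rewrite (integral_gaussmS mh h0).
have mc := measurable_cons_fun mh.
pose k (t : R) := \int[gaussm n]_y h (row_mx (\row_(_ < 1) t) y).
have mk : measurable_fun setT k.
  exact: (measurable_fun_fubini_tonelli_F (m2 := gaussm n) _ mc (fun=> h0 _)).
rewrite -[RHS](integral_normal_opp mk); last by move=> t; exact: integral_ge0.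
apply: eq_integral => t _; apply: eq_integral => y _; congr h.
rewrite (mul_row_block (n1 := 1)) !mulmx0 addr0 add0r mulmxN !mulmx1.
by congr row_mx; apply/rowP => i; rewrite !mxE.
Qed.

(** The block shape 1 + (1 + n) follows the recursion of [gaussm], which splits off one coordinate
    at a time. *)
Definition plane_rot n (c s : R) : 'M[R]_(1 + (1 + n)) :=
  block_mx c%:M (row_mx s%:M 0) (col_mx (- s)%:M 0) (block_mx c%:M 0 0 1%:M).

Lemma mul_plane_rot n (c s a b : R) (y : 'rV[R]_n) :
  row_mx a%:M (row_mx b%:M y) *m plane_rot n c s =
  row_mx (c * a - s * b)%:M (row_mx (s * a + c * b)%:M y) :> 'rV_(1 + (1 + n)).
Proof.
rewrite /plane_rot (mul_row_block (n1 := 1)) mul_mx_row mul_row_col mul_row_block.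
rewrite !mulmx0 mulmx1 addr0 add_row_mx !add0r addr0 -!scalar_mxM -!raddfD/=.
by congr (row_mx _%:M (row_mx _%:M _)); ring.
Qed.

(** Integrating out the last n coordinates leaves a function of the first two, to which
    [integral_normal_rotation] applies. *)
Lemma gauss_inv_rot n (c s : R) : s != 0%R -> (c ^+ 2 + s ^+ 2 = 1)%R ->
  gauss_inv (plane_rot n c s).
Proof.
move=> s0 cs h mh h0.
have sc (t : R) : (\row_(_ < 1) t)%R = t%:M%R.
  by apply/rowP => i; rewrite !mxE (ord1 i) eqxx mulr1n.
pose G (z : R * R * 'rV[R]_n) : 'rV[R]_(1 + (1 + n)) :=
  row_mx (\row_(_ < 1) z.1.1) (row_mx (\row_(_ < 1) z.1.2) z.2 : 'rV_(1 + n)).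
have mG : measurable_fun setT G.
  apply: measurable_row_mx; last apply: measurable_row_mx => //.
    apply: measurable_mxP => i j; under eq_fun do rewrite mxE.
    exact: (measurableT_comp measurable_fst measurable_fst).
  apply: measurable_mxP => i j; under eq_fun do rewrite mxE.
  exact: (measurableT_comp measurable_snd measurable_fst).
pose k (z : R * R) := \int[gaussm n]_y h (G (z, y)).
have mk : measurable_fun setT k.
  exact: (measurable_fun_fubini_tonelli_F (m2 := gaussm n) _
            (measurableT_comp mh mG) (fun=> h0 _)).
have k0 z : 0 <= k z by exact: integral_ge0.
have E (f : 'rV[R]_(n.+2) -> \bar R) : measurable_fun setT f -> (forall x, 0 <= f x) ->
    \int[gaussm n.+2]_x f x = \int[N]_t \int[N]_u \int[gaussm n]_y f (G ((t, u), y)).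
  move=> mf f0; rewrite integral_gaussmS//; apply: eq_integral => t _.
  rewrite integral_gaussmS//.
  exact: (measurable_fun_pair2 _ (measurable_cons_fun mf)).
have mhr : measurable_fun setT (fun x => h (x *m plane_rot n c s)).
  exact: (measurable_fun_mulmxr (m := n.+2)).
apply: (etrans (E _ mhr (fun=> h0 _))); apply/esym/(etrans (E _ mh h0)).
apply: (etrans (esym (integral_normal_rotation mk k0 s0 cs))).
apply: eq_integral => t _; apply: eq_integral => u _; apply: eq_integral => y _.
by rewrite /G !sc mul_plane_rot.
Qed.

End GaussInvariance.

Section LevelSets.
Context {R : realType} d (T : measurableType d) (f g : T -> R).
Hypotheses (mf : measurable_fun setT f) (mg : measurable_fun setT g).

Lemma measurable_set_eq : measurable [set t | f t = g t].
Proof.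
rewrite (_ : [set t | _] = setT `&` (fun t => f t == g t) @^-1` [set true]).
  by apply: measurable_fun_eqr.
by rewrite setTI; apply/seteqP; split=> t /= /eqP.
Qed.

Lemma measurable_set_le : measurable [set t | f t <= g t].
Proof.
rewrite (_ : [set t | _] = setT `&` (fun t => f t <= g t) @^-1` [set true]).
  by apply: measurable_fun_ler.
by rewrite setTI.
Qed.

Lemma measurable_set_lt : measurable [set t | f t < g t].
Proof.
rewrite (_ : [set t | _] = setT `&` (fun t => f t < g t) @^-1` [set true]).
  by apply: measurable_fun_ltr.
by rewrite setTI.
Qed.

End LevelSets.

Section OrthogonalBlocks.
Context {R : realType}.
(** The other rows are orthogonal to the first one, so their first entries vanish. *)
Lemma orth_row_block n (O : 'M[R]_(1 + n)) :
  orth O -> usubmx O = row_mx 1%:M 0 ->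
  exists2 Q : 'M[R]_n, orth Q & O = block_mx 1%:M 0 0 Q.
Proof.
move=> oO u.
have e := oO; rewrite /orth -(vsubmxK O) u tr_col_mx mul_col_row in e.
rewrite tr_row_mx trmx0 trmx1 in e.
rewrite [RHS]scalar_mx_block in e; have [_ _ e3 e4] := eq_block_mx e.
have l0 : lsubmx (dsubmx O) = 0%R.
  by move: e3; rewrite -{1}(hsubmxK (dsubmx O)) mul_row_col mulmx1 mulmx0 addr0.
exists (rsubmx (dsubmx O)).
  by move: e4; rewrite /orth -(hsubmxK (dsubmx O)) l0 row_mxKr tr_row_mx mul_row_col trmx0 mulmx0 add0r.
by rewrite -[LHS]vsubmxK u; congr col_mx; rewrite -[LHS]hsubmxK l0.
Qed.

Lemma dotv_usubmx n (O : 'M[R]_(1 + n)) :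
  orth O -> dotv (usubmx O) (usubmx O) = 1%R.
Proof.
move=> oO; have e := oO; rewrite /orth -(vsubmxK O) tr_col_mx mul_col_row in e.
rewrite [RHS]scalar_mx_block in e; have [e1 _ _ _] := eq_block_mx e.
by rewrite dotvE e1 mxE eqxx.
Qed.

Lemma tr_plane_rot n (c s : R) : (plane_rot n c s)^T = plane_rot n c (- s).
Proof.
rewrite /plane_rot (tr_block_mx (n1 := 1)) tr_row_mx tr_col_mx tr_block_mx !tr_scalar_mx.
by rewrite !trmx0 opprK.
Qed.

Lemma plane_rot_orth n (c s : R) :
  (c ^+ 2 + s ^+ 2 = 1)%R -> orth (plane_rot n c s).
Proof.
move=> cs; apply/row_matrixP => i; rewrite !rowE.
set e := delta_mx _ _; rewrite mulmx1 tr_plane_rot mulmxA.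
have -> : e = row_mx (lsubmx e 0 0)%:M (row_mx (lsubmx (rsubmx e) 0 0)%:M (rsubmx (rsubmx e))).
  by rewrite -!mx11_scalar !hsubmxK.
rewrite !mul_plane_rot; congr (row_mx _%:M (row_mx _%:M _)).
  by rewrite -[RHS]mul1r -cs; ring.
by rewrite -[RHS]mul1r -cs; ring.
Qed.

End OrthogonalBlocks.

Section GaussOrth.
Context {R : realType}.
Local Notation N := (normal_prob (0 : R) 1).
Local Open Scope ereal_scope.

(** Induction on the dimension: O is multiplied by a Gaussian-preserving orthogonal T that makes its
    first row the first basis vector. A block of size n remains, which the induction hypothesis
    covers. *)
Lemma gauss_orth n (O : 'M[R]_n) : orth O -> gauss_inv O.
Proof.
elim: n O => [|n IH] O oO.
  by move=> h _ _; apply: eq_integral => x _; congr h; rewrite !thinmx0.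
suff [T [oT iT uT]] : exists T : 'M[R]_(1 + n),
    [/\ orth T, gauss_inv T & usubmx (O : 'M[R]_(1 + n)) *m T = row_mx 1%:M 0].
  have [Q oQ OT] : exists2 Q : 'M[R]_n, orth Q & (O : 'M[R]_(1 + n)) *m T = block_mx 1%:M 0 0 Q.
    by apply: orth_row_block; [exact: orthM|rewrite -mul_usub_mx].
  have -> : O = block_mx 1%:M 0 0 Q *m T^T :> 'M[R]_(1 + n).
    by rewrite -OT -mulmxA oT mulmx1.
  by apply: gauss_invM; [exact/gauss_inv_block/IH|exact: gauss_invT].
have n1 := @dotv_usubmx R n O oO.
pose c := (usubmx (O : 'M[R]_(1 + n)) 0 0)%R; pose v := rsubmx (usubmx (O : 'M[R]_(1 + n))).
have uE : usubmx (O : 'M[R]_(1 + n)) = row_mx c%:M v.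
  rewrite -[LHS]hsubmxK; congr row_mx; rewrite [LHS]mx11_scalar; congr (_%:M)%R.
  by rewrite /c !mxE; congr (O _ _); apply: val_inj.
rewrite uE in n1 *; rewrite dotv_row dotv_scalar -expr2 in n1.
(* v = 0 forces c = 1 or c = -1; it is treated apart because [gauss_inv_rot] needs a nonzero
   sine. *)
have [v0|v0] := eqVneq v 0%R.
  move: n1; rewrite v0 dot0v addr0 => /eqP; rewrite sqrf_eq1 => /orP[]/eqP ->.
    by exists 1%:M; split; [exact: orth1|exact: gauss_inv1|rewrite mulmx1].
  exists (block_mx (- 1%:M) 0 0 1%:M); split.
  - apply: orth_block; last exact: orth1.
    by rewrite /orth linearN/= trmx1 mulmxN mulNmx mulmx1 opprK.
  - exact: gauss_inv_opp.
  - rewrite (mul_row_block (n1 := 1)) !mulmx0 !mul0mx !addr0 mulmxN mulmx1.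
    by rewrite -raddfN/= opprK.
case: n IH O oO v {uE} c n1 v0 => [|m] IH O oO v c n1 v0.
  by rewrite (thinmx0 v) eqxx in v0.
pose s := Num.sqrt (dotv v v).
have s2 : (s ^+ 2 = dotv v v)%R by rewrite sqr_sqrtr// dotvv_ge0.
have s0 : s != 0%R by rewrite -sqrf_eq0 s2 dotvv_eq0.
have cs : (c ^+ 2 + (- s) ^+ 2 = 1)%R by rewrite sqrrN s2.
pose w : 'rV[R]_(1 + m) := row_mx s%:M 0.
have vw : dotv v v = dotv w w by rewrite dotv_row dotv_scalar dot0v addr0 -expr2 s2.
(* H turns v into (|v|, 0) within the last coordinates, where the induction hypothesis applies; G
   then rotates (c, |v|) to (1, 0). *)
pose H := block_mx 1%:M 0 0 (hh v w) : 'M[R]_(1 + (1 + m)).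
pose G := plane_rot m c (- s).
exists (H *m G); split.
- apply: orthM; first by apply: orth_block; [exact: orth1|exact: hh_orth].
  exact: plane_rot_orth.
- apply: gauss_invM; last by apply: gauss_inv_rot; rewrite ?oppr_eq0.
  by apply: gauss_inv_block; apply: IH; exact: hh_orth.
- rewrite mulmxA (mul_row_block (n1 := 1)) !mulmx0 addr0 add0r mulmx1 hhE//.
  rewrite mul_plane_rot; congr (row_mx _%:M _).
    by rewrite mulNr opprK -!expr2 -[RHS]n1 s2.
  by rewrite mulNr mulrC addNr raddf0 row_mx0.
Qed.

Lemma integral_indicT d (T : measurableType d) (mu : {measure set T -> \bar R})
  (A : set T) : measurable A -> \int[mu]_x (\1_A x)%:E = mu A.
Proof. by move=> mA; rewrite integral_indic// setIT. Qed.

Lemma measurable_preim_mulmxr m n p (B : 'M[R]_(n, p)) (A : set 'M[R]_(m, p)) :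
  measurable A -> measurable [set x : 'M[R]_(m, n) | A (x *m B)].
Proof. by move=> mA; rewrite -[X in measurable X]setTI; exact: measurable_mulmxr. Qed.

Lemma gaussm_orth n (O : 'M[R]_n) (A : set 'rV[R]_n) : orth O -> measurable A ->
  gaussm n [set x | A (x *m O)] = gaussm n A.
Proof.
move=> oO mA; rewrite -!integral_indicT//; last exact: measurable_preim_mulmxr.
have := gauss_orth oO (h := fun x => (\1_A x)%:E).
by apply => //; exact/measurable_EFinP/measurable_indic.
Qed.

(** A reflection carries a to a multiple of the first basis vector, and the hyperplane becomes the
    vanishing of one normal coordinate. *)
Lemma gaussm_hyperplane n (a : 'rV[R]_n) : a != 0%R ->
  gaussm n [set x | dotv x a = 0%R] = 0.
Proof.
case: n a => [|n] a a0; first by rewrite (thinmx0 a) eqxx in a0.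
pose s := Num.sqrt (dotv a a).
have s2 : (s ^+ 2 = dotv a a)%R by rewrite sqr_sqrtr// dotvv_ge0.
have s0 : s != 0%R by rewrite -sqrf_eq0 s2 dotvv_eq0.
pose w : 'rV[R]_(1 + n) := row_mx s%:M 0.
have aw : dotv a a = dotv w w by rewrite dotv_row dotv_scalar dot0v addr0 -expr2 s2.
pose A := [set x : 'rV[R]_n.+1 | dotv x w = 0%R].
have mA : measurable A.
  by apply: measurable_set_eq => //; exact: measurable_dotv.
rewrite (_ : [set x | _] = [set x | A (x *m hh a w)]); last first.
  by apply/seteqP; split=> x /=; rewrite /A/= -{2}(hhE aw) dotv_orth//; exact: hh_orth.
rewrite gaussm_orth//; last exact: hh_orth.
rewrite -integral_indicT// integral_gaussmS//; last first.
  exact/measurable_EFinP/measurable_indic.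
transitivity (\int[N]_t (\1_[set 0%R] t)%:E).
  apply: eq_integral => t _.
  rewrite (eq_integral (cst (\1_[set 0%R] t)%:E)) => [|y _].
    rewrite integral_cst// -[RHS]mule1; congr (_ * _); exact: (probability_setT (gaussm n)).
  congr (_%:E); rewrite !indicE; congr (nat_of_bool _)%:R.
  rewrite -[X in row_mx X y](_ : t%:M%R = _); last first.
    by apply/rowP => i; rewrite !mxE (ord1 i) eqxx mulr1n.
  have e : (dotv (row_mx t%:M y) w = t * s)%R.
    by rewrite (dotv_row (t%:M)%R) dotv_scalar dotv0 addr0.
  apply/idP/idP; rewrite !inE /A/= [dotv _ _]e.
    by move/eqP; rewrite mulf_eq0 (negbTE s0) orbF => /eqP.
  by move=> ->; rewrite mul0r.
rewrite integral_indic// setIT.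
have /null_content_dominatesP := @normal_prob_dominates R 0 1.
by apply; [exact: measurable_set1|exact: lebesgue_measure_set1].
Qed.
End GaussOrth.

(** * Random orthogonal matrices and rotation-invariant laws *)

Section RandomOrthogonal.
Context {R : realType}.

Lemma measurable_inv_ge0 d (T : measurableType d) (f : T -> R) :
  (forall t, 0 <= f t) ->
  measurable_fun setT f -> measurable_fun setT (fun t => (f t)^-1).
Proof.
move=> f0 mf; rewrite (_ : (fun t => _) = fun t => powR (f t) (-1)).
  exact: (measurableT_comp (measurable_powR _) mf).
by apply/funext => t; rewrite powR_inv1.
Qed.

Lemma measurable_hh d (T : measurableType d) n (x y : T -> 'rV[R]_n) :
  measurable_fun setT x -> measurable_fun setT y ->
  measurable_fun setT (fun t => hh (x t) (y t)).
Proof.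
move=> mx my.
have mv : measurable_fun setT (fun t => x t - y t).
  apply: measurable_addmx => //; under eq_fun do rewrite -scaleN1r.
  exact: measurable_scalemx.
have mP : measurable_fun setT
    (fun t => (2 / dotv (x t - y t) (x t - y t)) *: ((x t - y t)^T *m (x t - y t))).
  apply: measurable_scalemx.
    apply: measurable_funM => //; apply: measurable_inv_ge0; last exact: measurable_dotv.
    by move=> t; exact: dotvv_ge0.
  by apply: measurable_mulmx => //; exact: measurable_trmx.
apply: measurable_addmx => //; under eq_fun do rewrite -scaleN1r.
exact: measurable_scalemx.
Qed.

Lemma hhT n (x y : 'rV[R]_n) : (hh x y)^T = hh x y.
Proof.
rewrite /hh; set v := x - y; have : (v^T *m v)^T = v^T *m v by rewrite trmx_mul trmxK.
by move: (v^T *m v) => P PT; rewrite linearB/= trmx1 [(_ *: P)^T]linearZ/= PT.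
Qed.

Definition scaled_e1 n (g : 'rV[R]_(1 + n)) : 'rV[R]_(1 + n) :=
  row_mx (Num.sqrt (dotv g g))%:M 0.

Lemma scaled_e1_norm n (g : 'rV[R]_(1 + n)) :
  dotv (scaled_e1 g) (scaled_e1 g) = dotv g g.
Proof. by rewrite dotv_row dotv_scalar dot0v addr0 -expr2 sqr_sqrtr// dotvv_ge0. Qed.

(** The reflection is symmetric and sends |g| e_1 to g, so the first coordinate of the image of x is
    the component of x along g. *)
Lemma hh_scaled_e1 n (x g : 'rV[R]_(1 + n)) : g != 0 ->
  lsubmx (x *m hh (scaled_e1 g) g) = (dotv x g / Num.sqrt (dotv g g))%:M.
Proof.
move=> g0; set s := Num.sqrt _.
have s0 : s != 0 by rewrite sqrtr_eq0 -ltNge lt_neqAle eq_sym dotvv_eq0 g0 dotvv_ge0.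
set H := hh _ _; have := hhE (scaled_e1_norm g); rewrite -/H => eH.
have : dotv (x *m H) (scaled_e1 g) = dotv x g.
  by rewrite dotv_mulmx hhT -/H eH.
rewrite -{1}(hsubmxK (x *m H)) dotv_row dotv0 addr0 [lsubmx _]mx11_scalar dotv_scalar => <-.
by rewrite mulfK.
Qed.

Local Open Scope ereal_scope.

(* In dimension n + 1, reflect |g| e_1 to a Gaussian vector g and then apply a
   random orthogonal matrix of dimension n to the other coordinates: the law of
   u *m Q is determined by |u| and the law of the first coordinate <u, g> / |g|. *)
Lemma random_orth n : exists d (W : measurableType d) (P : probability W R)
    (Q : W -> 'M[R]_n), [/\ measurable_fun setT Q, forall w, orth (Q w) &
  forall (u u' : 'rV[R]_n) (h : 'rV[R]_n -> \bar R), measurable_fun setT h ->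
    (forall x, 0 <= h x) -> dotv u u = dotv u' u' ->
    \int[P]_w h (u *m Q w) = \int[P]_w h (u' *m Q w)].
Proof.
elim: n => [|n [d [W [P [Q [mQ oQ iQ]]]]]].
  exists _, unit, (\d_tt : probability _ R), (fun=> 1%:M); split => //.
    by move=> _; exact: orth1.
  by move=> u u' h _ _ _; apply: eq_integral => w _; rewrite (thinmx0 u) (thinmx0 u').
pose D w : 'M[R]_(1 + n) := block_mx 1%:M 0 0 (Q w).
have mD : measurable_fun setT D.
  apply: measurable_col_mx; apply: measurable_row_mx => //.
pose H (g : 'rV[R]_(1 + n)) := hh (scaled_e1 g) g.
have mH : measurable_fun setT H.
  apply: measurable_hh => //; apply: measurable_row_mx => //.
  apply: measurable_mxP => i j.
  rewrite (_ : (fun g => _) = fun g : 'rV[R]_(1 + n) => Num.sqrt (dotv g g)); last first.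
    by apply/funext => g; rewrite mxE !ord1 eqxx mulr1n.
  by apply: measurable_sqrt; exact: measurable_dotv.
pose Q' (gw : 'rV[R]_(1 + n) * W) := H gw.1 *m D gw.2.
have mQ' : measurable_fun setT Q'.
  by apply: measurable_mulmx; [exact: (measurableT_comp mH)|exact: (measurableT_comp mD)].
have oQ' w : orth (Q' w).
  rewrite /Q' /H /D; apply: orthM; first exact: hh_orth.
  by apply: orth_block; [exact: orth1|exact: oQ].
exists _, _, (gaussm n.+1 \x P : probability _ R), Q'; split => //.
move=> u u' h mh h0 uu'.
pose Psi (x : 'rV[R]_(1 + n)) := \int[P]_w h (x *m D w).
have PsiR a y y' : dotv y y = dotv y' y' -> Psi (row_mx a y) = Psi (row_mx a y').
  have PsiRE z : Psi (row_mx a z) = \int[P]_w h (row_mx a (z *m Q w)).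
    by apply: eq_integral => w _; rewrite /D mul_row_block !mulmx0 mulmx1 addr0 add0r.
  move=> yy'; rewrite !PsiRE; apply: (iQ y y' (fun z => h (row_mx a z))) => //.
  have mr : measurable_fun setT (fun z : 'rV[R]_n => row_mx a z : 'rV[R]_(1 + n)).
    exact: measurable_row_mx.
  exact: (measurableT_comp mh mr).
(* Given the first coordinate, the full norm fixes the norm of the remaining ones, which is all that
   the induction hypothesis sees. *)
have PsiE x x' : lsubmx x = lsubmx x' -> dotv x x = dotv x' x' -> Psi x = Psi x'.
  move=> xl xx; rewrite -(hsubmxK x) -(hsubmxK x') xl; apply: PsiR.
  move: xx; rewrite -{1 2}(hsubmxK x) -{1 2}(hsubmxK x') !dotv_row xl; exact: addrI.
have mhQ v : measurable_fun setT (fun gw => h (v *m Q' gw)).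
  by apply: (measurableT_comp mh); exact: measurable_mulmx.
have QE v : \int[gaussm n.+1 \x P]_gw h (v *m Q' gw) = \int[gaussm n.+1]_g Psi (v *m H g).
  apply: (etrans (fubini_tonelli1 _ (mhQ v) (fun=> h0 _))).
  apply: eq_integral => g _; apply: eq_integral => w _.
  by rewrite /Q' mulmxA.
have mPsi v : measurable_fun setT (fun g => Psi (v *m H g)).
  have := measurable_fun_fubini_tonelli_F (m2 := P) _ (mhQ v) (fun=> h0 _).
  rewrite /fubini_F; under eq_fun do under eq_integral do rewrite /Q' mulmxA.
  by [].
have Psi0 x : 0 <= Psi x by exact: integral_ge0.
rewrite !QE.
(* Replacing g by g O costs nothing for a Gaussian g, and <u', g O> = <u O, g O> = <u, g>: both
   integrands then see the same first coordinate and the same norm. *)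
pose O := hh u u'; have oO : orth O := hh_orth u u'.
have uO : u *m O = u' := hhE uu'.
rewrite -[RHS](gauss_orth oO (mPsi u') (fun=> Psi0 _)).
have muO : measurable_fun setT (fun g => Psi (u' *m H (g *m O))).
  exact: (measurable_fun_mulmxr (m := 1 + n) O (mPsi u')).
apply: (ge0_ae_eq_integral measurableT (mPsi u) muO
  (fun x _ => Psi0 _) (fun x _ => Psi0 _)).
pose e1 : 'rV[R]_(1 + n) := row_mx 1%:M 0.
(* Only g = 0 has to be discarded; this hyperplane is a null set containing it. *)
exists [set g | dotv g e1 = 0%R]; split.
- by apply: measurable_set_eq => //; exact: measurable_dotv.
- apply: gaussm_hyperplane; apply/eqP => /(congr1 (fun x : 'rV[R]_(1 + n) => lsubmx x 0%R 0%R)).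
  by rewrite row_mxKl !mxE => /eqP; rewrite oner_eq0.
- move=> g /= ng; have [->|g0] := eqVneq g 0%R; first by rewrite dot0v.
  exfalso; apply: ng => _; apply: PsiE.
    rewrite !hh_scaled_e1//; last first.
      by rewrite -dotvv_eq0 dotv_orth// dotvv_eq0.
    by rewrite -uO !dotv_orth.
  by rewrite !dotv_orth//; exact: hh_orth.
Qed.
End RandomOrthogonal.

Section ConeAverage.
Context {R : realType}.
Local Open Scope ereal_scope.

Definition scale_inv n (K : set 'rV[R]_n) : Prop :=
  forall (a : R) x, (0 < a)%R -> K x -> K (a *: x)%R.

Lemma scale_invE n (K : set 'rV[R]_n) (a : R) x : scale_inv K -> (0 < a)%R ->
  (a *: x \in K)%R = (x \in K).
Proof.
move=> cK a0; apply/idP/idP; rewrite !inE; last exact: cK.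
by move=> /(cK a^-1)%R; rewrite invr_gt0 scalerA mulVf ?gt_eqF// scale1r; apply.
Qed.

Lemma integral_probability_cst d (T : measurableType d) (P : probability T R)
  (r : \bar R) : 0 <= r -> \int[P]_x r = r.
Proof.
by move=> r0; rewrite integral_cst// -[RHS]mule1; congr (_ * _); exact: (probability_setT P).
Qed.

Lemma measurable_rV_set1 n (z : 'rV[R]_n) : measurable [set x : 'rV[R]_n | x = z].
Proof.
rewrite (_ : [set x | _] = \bigcap_(i in [set: 'I_n]) [set x : 'rV[R]_n | x ord0 i = z ord0 i]).
  apply: fin_bigcap_measurable => // i _.
  by apply: measurable_set_eq => //; exact: measurable_entry.
by apply/seteqP; split=> [x -> //|x xz]; apply/rowP => i; exact: xz.
Qed.

Lemma gaussm0 n : (0 < n)%N -> gaussm n [set x : 'rV[R]_n | x = 0%R] = 0.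
Proof.
case: n => // n _; pose e1 : 'rV[R]_(1 + n) := row_mx 1%:M 0.
have e0 : e1 != 0%R.
  apply/eqP => /(congr1 (fun x : 'rV[R]_(1 + n) => lsubmx x 0%R 0%R)).
  by rewrite row_mxKl !mxE => /eqP; rewrite oner_eq0.
apply/eqP; rewrite eq_le measure_ge0 andbT -(gaussm_hyperplane e0).
apply: le_measure; rewrite ?inE//; first exact: measurable_rV_set1.
  by apply: measurable_set_eq => //; exact: measurable_dotv.
by move=> x ->; exact: dot0v.
Qed.

(* Averaging over a random orthogonal matrix Q: the law of u *m Q depends only
   on the norm of u, so a cone is hit with a probability independent of u. *)
Lemma cone_average n (K : set 'rV[R]_n) dX (X : measurableType dX)
    (m : {sigma_finite_measure set X -> \bar R}) (F : X -> \bar R) (U : X -> 'rV[R]_n) :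
  measurable K -> scale_inv K -> K 0%R ->
  measurable_fun setT F -> (forall x, 0 <= F x) -> measurable_fun setT U ->
  (forall O, orth O -> \int[m]_x (F x * (\1_K (U x *m O))%:E) =
                       \int[m]_x (F x * (\1_K (U x))%:E)) ->
  ((0 < n)%N -> m.-negligible [set x | U x = 0%R]) ->
  \int[m]_x (F x * (\1_K (U x))%:E) = gaussm n K * \int[m]_x F x.
Proof.
move=> mK cK K0 mF F0 mU iU U0.
have mI : measurable_fun setT (fun x : 'rV[R]_n => (\1_K x : R)%:E).
  exact/measurable_EFinP/measurable_indic.
have I0 x : 0 <= (\1_K x : R)%:E by rewrite lee_fin.
(* In dimension 0 the only vector is 0, which lies in K; hence nullity of {U = 0} is demanded for n
   > 0 only. *)
have [n0|n0] := posnP n.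
  have KT : K = setT.
    apply/seteqP; split => // x _; suff -> : x = 0%R by [].
    by apply/rowP => l; have := ltn_ord l; rewrite [X in (_ < X)%N]n0 ltn0.
  rewrite KT [gaussm n setT](probability_setT (gaussm n)) mul1e.
  by apply: eq_integral => x _; rewrite indicT mule1.
have {}U0 := U0 n0.
have [d [W [P [Q [mQ oQ iQ]]]]] := @random_orth R n.
pose phi u := \int[P]_w (\1_K (u *m Q w) : R)%:E.
have phi0 u : 0 <= phi u by exact: integral_ge0.
have phiE u u' : u != 0%R -> u' != 0%R -> phi u = phi u'.
  (* [a] rescales u' to the norm of u, and K is insensitive to it. *)
  move=> u0 u'0; pose a := (Num.sqrt (dotv u u) / Num.sqrt (dotv u' u'))%R.
  have p v : v != 0%R -> (0 < Num.sqrt (dotv v v))%R.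
    by move=> v0; rewrite sqrtr_gt0 lt_neqAle eq_sym dotvv_eq0 v0 dotvv_ge0.
  have a0 : (0 < a)%R by rewrite divr_gt0 ?p.
  transitivity (phi (a *: u')%R).
    apply: (iQ u _ (fun x => (\1_K x)%:E)) => //.
    rewrite dotvZl dotvZr mulrA -expr2 expr_div_n !sqr_sqrtr ?dotvv_ge0// divfK//.
    by rewrite dotvv_eq0.
  by apply: eq_integral => w _; rewrite !indicE -scalemxAl scale_invE.
have mphi : measurable_fun setT (fun u => phi u).
  have mIQ : measurable_fun setT (fun uw : 'rV[R]_n * W => (\1_K (uw.1 *m Q uw.2) : R)%:E).
    apply: (measurableT_comp mI); apply: measurable_mulmx => //.
    exact: (measurableT_comp mQ).
  exact: (measurable_fun_fubini_tonelli_F (m2 := P) _ mIQ (fun=> I0 _)).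
(* The constant value of [phi] is found by integrating it against the Gaussian, which every Q w
   preserves. *)
have phi_gauss : \int[gaussm n]_u phi u = gaussm n K.
  have mIQ : measurable_fun setT (fun uw : 'rV[R]_n * W => (\1_K (uw.1 *m Q uw.2) : R)%:E).
    apply: (measurableT_comp mI); apply: measurable_mulmx => //.
    exact: (measurableT_comp mQ).
  apply: (etrans (fubini_tonelli (m1 := gaussm n) (m2 := P) _ mIQ (fun=> I0 _))).
  rewrite -[RHS](integral_probability_cst P)//; apply: eq_integral => w _ /=.
  by rewrite (gauss_orth (oQ w) mI)// integral_indicT.
have phiK u : u != 0%R -> phi u = gaussm n K.
  move=> u0; rewrite -phi_gauss.
  apply: (etrans (esym (integral_probability_cst (gaussm n) (phi0 u)))).
  apply: ge0_ae_eq_integral => //.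
  exists [set x | x = 0%R]; split; [|exact: gaussm0|].
    exact: measurable_rV_set1.
  by move=> x /= nx; apply: contrapT => /eqP x0; apply: nx => _; exact: phiE.
have mFI : measurable_fun setT (fun wx : W * X => F wx.2 * (\1_K (U wx.2 *m Q wx.1))%:E).
  apply: emeasurable_funM; first exact: (measurableT_comp mF).
  apply: (measurableT_comp mI); apply: measurable_mulmx.
    exact: (measurableT_comp mU).
  exact: (measurableT_comp mQ).
have FI0 wx : 0 <= F wx.2 * (\1_K (U wx.2 *m Q wx.1))%:E by rewrite mule_ge0.
transitivity (\int[P]_w \int[m]_x (F x * (\1_K (U x *m Q w))%:E)).
  rewrite -[LHS](integral_probability_cst P); last first.
    by apply: integral_ge0 => x _; rewrite mule_ge0.
  by apply: eq_integral => w _; rewrite iU.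
rewrite (fubini_tonelli (m1 := P) (m2 := m) _ mFI (fun=> FI0 _)) -ge0_integralZl//.
transitivity (\int[m]_x (F x * phi (U x))).
  apply: eq_integral => x _ /=; rewrite ge0_integralZl//.
  apply: (measurableT_comp mI); exact: measurable_mulmx.
apply: ge0_ae_eq_integral => //.
- by apply: emeasurable_funM => //; exact: (measurableT_comp mphi).
- exact: emeasurable_funM.
- by move=> x _; rewrite mule_ge0.
- by move=> x _; rewrite mule_ge0.
apply: negligibleS U0 => x /= nx; apply: contrapT => /eqP x0; apply: nx => _.
by rewrite phiK// muleC.
Qed.
End ConeAverage.

(** * Invariance of the Haar rotation *)

Section HaarInvariance.
Context {R : realType} (d : nat).
Variables (dT : measure_display) (T : measurableType dT) (P : probability T R)
  (rot : T -> 'M[R]_d).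
Hypothesis haar : haar_rotation P rot.

Lemma rot_SO t : is_SO (rot t). Proof. by case: haar. Qed.

Lemma is_SO_T (M : 'M[R]_d) : is_SO M -> is_SO M^T.
Proof. by move=> [oM dM]; split; [exact: orthT|rewrite det_tr]. Qed.

Lemma measurable_rot : measurable_fun setT rot.
Proof.
case: haar => _ mh _; apply: measurable_mxP => i j.
by apply: (mh (fun M : 'M[R]_d => M i j)); exact: coord_continuous.
Qed.

Local Open Scope ereal_scope.

(** A pi-system generating the measurable sets. Continuity of h feeds the Haar hypothesis,
    measurability of h keeps the set in the sigma-algebra of the entries. *)
Definition cozero_sets : set (set 'M[R]_d) :=
  [set A | exists h : 'M[R]_d -> R, [/\ continuous h, measurable_fun setT h &
    A = [set M | (0 < h M)%R]]].

Lemma cozero_setsI : setI_closed cozero_sets.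
Proof.
move=> _ _ [h [ch mh ->]] [k [ck mk ->]]; exists (fun M => Num.min (h M) (k M)); split.
- by move=> M; apply: continuous_min; [exact: ch|exact: ck].
- exact: measurable_minr.
- by apply/seteqP; split=> M /=; rewrite lt_min => /andP.
Qed.

(** Open half-lines generate the Borel sets of the line, and {M i j > x} is the cozero set of M i j
    - x. *)
Lemma measurable_cozero : measurable = <<s cozero_sets >> :> set (set 'M[R]_d).
Proof.
apply/seteqP; split; last first.
  apply: smallest_sub; first exact: sigma_algebra_measurable.
  by move=> _ [h [_ mh ->]]; apply: measurable_set_lt.
apply: smallest_sub; first exact: smallest_sigma_algebra.
move=> _ [i [j [B [mB ->]]]].
have mc : measurable_fun [set: g_sigma_algebraType cozero_sets]
    (fun M : g_sigma_algebraType cozero_sets => (M : 'M[R]_d) i j).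
  have mG : @measurable _ R = <<s @RGenOInfty.G R >> by exact: RGenOInfty.measurableE.
  have mm := @measurability _ _ (g_sigma_algebraType cozero_sets) R setT
    (fun M : g_sigma_algebraType cozero_sets => (M : 'M[R]_d) i j) _ mG.
  apply: mm => _ [_ [x ->] <-].
  rewrite setTI; apply: sub_sigma_algebra.
  exists (fun M => M i j - x)%R; split.
  - by move=> M; apply: continuousB; [exact: coord_continuous|exact: cst_continuous].
  - by apply: measurable_funB => //; exact: measurable_entry.
  - by apply/seteqP; split=> M /=; rewrite in_itv/= andbT subr_gt0.
by have := mc measurableT B mB; rewrite setTI.
Qed.

(* The indicator of [0 < h] is the increasing limit of the continuous functions
   min (1, n * max (0, h)). *)
Lemma rot_cozero (A : set 'M[R]_d) (g : 'M[R]_d) : is_SO g -> cozero_sets A ->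
  P [set t | A (g *m rot t)] = P [set t | A (rot t)].
Proof.
move=> gSO [h [ch mh ->]].
pose hn (n : nat) M := Num.min 1%R (n%:R * Num.max 0%R (h M))%R.
have chn n : continuous (hn n).
  move=> M; apply: (continuous_min (f := cst 1%R)
    (g := fun M => (n%:R * Num.max 0 (h M))%R)); first exact: cst_continuous.
  have cmax : {for M, continuous (fun M => Num.max 0%R (h M))}.
    by apply: (continuous_max (f := cst 0%R)); [exact: cst_continuous|exact: ch].
  exact: (continuousM (s := cst n%:R) (@cst_continuous _ _ _ _) cmax).
have mhn n : measurable_fun setT (hn n).
  by apply: measurable_minr => //; apply: measurable_funM => //; exact: measurable_maxr.
have hn0 n M : (0 <= hn n M)%R by rewrite le_min ler01 mulr_ge0// le_max lexx.
have cvg_ind (f : T -> 'M[R]_d) : measurable_fun setT f ->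
    \int[P]_t (hn n (f t))%:E @[n --> \oo] --> P [set t | (0 < h (f t))%R].
  move=> mf; rewrite -integral_indicT; last first.
    by apply: measurable_set_lt => //; exact: (measurableT_comp mh).
  have -> : \int[P]_t (\1_[set t | (0 < h (f t))%R] t)%:E =
     \int[P]_t limn (fun n => (hn n (f t))%:E).
    apply: eq_integral => t _; apply/esym/cvg_lim => //.
    rewrite indicE /hn; have [h0|h0] := ltP 0%R (h (f t)); last first.
      rewrite memNset/=; last by rewrite /= ltNge h0.
      under eq_fun do rewrite mulr0 min_r//; exact: cvg_cst.
    rewrite mem_set//=; apply: cvg_near_cst; near=> n; congr (_%:E); apply: min_l.
    rewrite -ler_pdivrMr// mul1r; near: n; exact: nbhs_infty_ger.
  apply: cvg_monotone_convergence => //.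
  - by move=> n; apply/measurable_EFinP; exact: (measurableT_comp (mhn n)).
  - by move=> n t _; rewrite lee_fin.
  - move=> t _ a b ab; rewrite lee_fin /hn le_min ge_min lexx/= ge_min.
    by rewrite ler_wpM2r ?orbT// ?ler_nat// le_max lexx.
have mg : measurable_fun setT (fun t => g *m rot t).
  by apply: measurable_mulmx => //; exact: measurable_rot.
apply: (cvg_unique _ (cvg_ind _ mg)) => //.
have -> : (fun n => \int[P]_t (hn n (g *m rot t))%:E) =
          (fun n => \int[P]_t (hn n (rot t))%:E).
  by apply/funext => n; case: haar => _ _; exact.
exact: (cvg_ind _ measurable_rot).
Unshelve. all: by end_near. Qed.

(** The laws of g *m rot and of rot are finite measures agreeing on the generating pi-system of
    cozero sets, hence equal. *)
Lemma rot_left_inv (g : 'M[R]_d) (h : 'M[R]_d -> \bar R) : is_SO g ->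
  measurable_fun setT h -> (forall M, 0 <= h M) ->
  \int[P]_t h (g *m rot t) = \int[P]_t h (rot t).
Proof.
move=> gSO mh h0.
have mg : measurable_fun setT (fun t => g *m rot t).
  by apply: measurable_mulmx => //; exact: measurable_rot.
have E (f : T -> 'M[R]_d) : measurable_fun setT f ->
    \int[P]_t h (f t) = \int[pushforward P f]_M h M.
  by move=> mf; rewrite ge0_integral_pushforward.
have mr := measurable_rot.
apply: (etrans (E _ mg)); apply/esym/(etrans (E _ mr)).
apply: eq_measure_integral => A mA _.
have GT (i : nat) : cozero_sets setT.
  exists (cst 1%R); split => //; first by move=> M; exact: cst_continuous.
  by apply/seteqP; split=> M //= _; rewrite ltr01.
refine (@measure_unique _ R _ cozero_sets (fun=> setT) measurable_cozero cozero_setsI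
  GT _ _ _ _ _ A mA).
- by rewrite bigcup_const.
- by move=> B cB; apply/esym; exact: rot_cozero.
- move=> _; apply: (@le_lt_trans _ _ 1); last by rewrite ltry.
  by rewrite /= /pushforward preimage_setT probability_setT.
Qed.

(* Both sides equal the double integral of h ((rot s)^T *m rot t). *)
Lemma rot_trmx (h : 'M[R]_d -> \bar R) :
  measurable_fun setT h -> (forall M, 0 <= h M) ->
  \int[P]_t h (rot t)^T = \int[P]_t h (rot t).
Proof.
move=> mh h0.
have mr := measurable_rot.
have mhh : measurable_fun setT (fun st : T * T => h ((rot st.1)^T *m rot st.2)).
  apply: (measurableT_comp mh); apply: measurable_mulmx.
    by apply: measurable_trmx; exact: (measurableT_comp mr).
  exact: (measurableT_comp mr).
have E (k : 'M[R]_d -> \bar R) s : measurable_fun setT k -> (forall M, 0 <= k M) ->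
    \int[P]_t k ((rot s)^T *m rot t) = \int[P]_t k (rot t).
  by move=> mk k0; apply: rot_left_inv => //; exact/is_SO_T/rot_SO.
have i0 (k : 'M[R]_d -> \bar R) (f : T -> 'M[R]_d) :
    (forall M, 0 <= k M) -> 0 <= \int[P]_t k (f t) by move=> k0; exact: integral_ge0.
transitivity (\int[P]_t \int[P]_s h ((rot s)^T *m rot t)).
  rewrite -[LHS](integral_probability_cst P)//; last exact: i0.
  apply: eq_integral => t _.
  rewrite -(E (fun M => h M^T) t)//; last first.
    by apply: (measurableT_comp mh); exact: measurable_trmx.
  by apply: eq_integral => s _; rewrite trmx_mul trmxK.
rewrite -(fubini_tonelli (m1 := P) (m2 := P) _ mhh (fun=> h0 _)).
rewrite -[RHS](integral_probability_cst P)//; last exact: i0.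
by apply: eq_integral => s _; rewrite E.
Qed.

(** Transposition preserves the law and turns right multiplication into left multiplication. *)
Lemma rot_right_inv (g : 'M[R]_d) (h : 'M[R]_d -> \bar R) : is_SO g ->
  measurable_fun setT h -> (forall M, 0 <= h M) ->
  \int[P]_t h (rot t *m g) = \int[P]_t h (rot t).
Proof.
move=> gSO mh h0.
have mhT : measurable_fun setT (fun M : 'M[R]_d => h M^T).
  by apply: (measurableT_comp mh); exact: measurable_trmx.
rewrite -(rot_trmx mh h0) -(rot_left_inv (is_SO_T gSO) mhT (fun=> h0 _)).
rewrite -(rot_trmx (h := fun M => h (M *m g)))//.
  by apply: eq_integral => t _; rewrite trmx_mul trmxK.
by apply: (measurableT_comp mh); exact: measurable_mulmx.
Qed.

End HaarInvariance.

(** * Gram matrices and orthonormal bases *)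

Section LinearAlgebra.
Context {R : realType}.

Definition gram m n (M : 'M[R]_(m, n)) : 'M[R]_m := M *m M^T.

Lemma gram_mulr m n (M : 'M[R]_(m, n)) O : orth O -> gram (M *m O) = gram M.
Proof. by move=> oO; rewrite /gram trmx_mul mulmxA -(mulmxA M) oO mulmx1. Qed.

Lemma gram_mull m m' n (A : 'M[R]_(m', m)) (M : 'M[R]_(m, n)) :
  gram (A *m M) = A *m gram M *m A^T.
Proof. by rewrite /gram trmx_mul !mulmxA. Qed.

Lemma orth_det n (O : 'M[R]_n) : orth O -> \det O * \det O = 1.
Proof. by move=> oO; rewrite -{2}det_tr -det_mulmx oO det1. Qed.

Lemma det_gram_orthl m n (A : 'M[R]_m) (M : 'M[R]_(m, n)) : orth A ->
  \det (gram (A *m M)) = \det (gram M).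
Proof. by move=> oA; rewrite gram_mull !det_mulmx det_tr mulrAC orth_det// mul1r. Qed.

Lemma dotv_gram m n (M : 'M[R]_(m, n)) (x y : 'rV[R]_m) :
  dotv (x *m gram M) y = dotv (x *m M) (y *m M).
Proof. by rewrite /gram mulmxA dotv_mulmx trmxK. Qed.

(** A row vector x killed by the Gram matrix satisfies |x M|^2 = 0. *)
Lemma det_gram_neq0 m n (M : 'M[R]_(m, n)) : (\det (gram M) != 0) = row_free M.
Proof.
rewrite -unitfE -unitmxE -row_free_unit; apply/idP/idP => h; apply/row_freeP.
  have [X /= hX] := row_freeP h.
  by exists (M^T *m X); rewrite mulmxA.
suff : row_free (gram M) by move/row_freeP.
rewrite -kermx_eq0; apply/eqP/row_matrixP => l; rewrite row0.
have := mulmx_ker (gram M) => /(congr1 (row l)); rewrite row_mul row0 => k0.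
have : dotv (row l (kermx (gram M)) *m M) (row l (kermx (gram M)) *m M) = 0.
  by rewrite -dotv_gram k0 dot0v.
move=> /eqP; rewrite dotvv_eq0 => /eqP e.
by apply: (row_free_inj h); rewrite e mul0mx.
Qed.

Lemma block_gram m n (a : 'rV[R]_1) (x : 'cV[R]_m) (M : 'M[R]_(m, n)) :
  gram (block_mx a 0 x M) =
  block_mx a 0 x 1%:M *m block_mx 1%:M 0 0 (gram M) *m (block_mx a 0 x 1%:M)^T.
Proof.
rewrite /gram !tr_block_mx !trmx0 !trmx1 !mulmx_block !mulmx0 !mul0mx !mulmx1 !mul1mx.
by rewrite !addr0 !add0r.
Qed.

(** For squared volumes: length of the first edge times the volume of the other edges projected off
    it. *)
Lemma det_block_gram m n (a : R) (x : 'cV[R]_m) (M : 'M[R]_(m, n)) :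
  \det (gram (block_mx a%:M 0 x M)) = a ^+ 2 * \det (gram M).
Proof.
rewrite block_gram !det_mulmx det_tr !det_lblock !det1 mulr1 mul1r det_scalar1.
by rewrite mulrAC -expr2.
Qed.

(* The upper bound matters because f is only assumed measurable on [0, 1]. *)
Lemma det_gram_bounds m n (M : 'M[R]_(m, n)) :
  (forall l, dotv (row l M) (row l M) <= 1) -> 0 <= \det (gram M) <= 1.
Proof.
elim: m n M => [|m IH] n M hM; first by rewrite det_mx00 ler01 lexx.
case: n M hM => [|n] M hM.
  by rewrite /gram (thinmx0 M) mul0mx det0 lexx ler01.
pose r : 'rV[R]_(1 + n) := usubmx (M : 'M[R]_(1 + m, 1 + n)).
(* Hadamard's inequality by induction: once the first row points along the first axis, deleting the
   first column only shortens the other rows. *)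
pose H := hh r (scaled_e1 r).
have eH : r *m H = scaled_e1 r by rewrite hhE// scaled_e1_norm.
pose M' : 'M[R]_(1 + m, 1 + n) := (M : 'M[R]_(1 + m, 1 + n)) *m H.
have oH : orth H := hh_orth _ _.
have gM : gram M = gram M' by rewrite gram_mulr.
have hM' l : dotv (row l M') (row l M') <= 1.
  by rewrite row_mul dotv_orth//; exact: hM.
have uM' : usubmx M' = scaled_e1 r by rewrite -mul_usub_mx.
have M'E : M' = block_mx (Num.sqrt (dotv r r))%:M 0 (dlsubmx M') (drsubmx M').
  by rewrite -[LHS]submxK /ulsubmx /ursubmx uM' row_mxKl row_mxKr.
have r1 : dotv r r <= 1.
  have := hM' (lshift m 0); rewrite -[row _ M'](_ : r *m H = _).
    by rewrite dotv_orth.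
  by rewrite eH -uM'; apply/rowP => l; rewrite !mxE.
have drow l : dotv (row l (drsubmx M')) (row l (drsubmx M')) <= 1.
  apply: le_trans (hM' (rshift 1 l)).
  rewrite [X in row (rshift 1 l) X]M'E.
  have -> : row (rshift 1 l) (block_mx (Num.sqrt (dotv r r))%:M 0 (dlsubmx M') (drsubmx M'))
      = row_mx (row l (dlsubmx M')) (row l (drsubmx M')).
    by rewrite rowKd row_row_mx.
  by rewrite dotv_row lerDr dotvv_ge0.
have /andP[d0 d1] := IH _ _ drow.
have -> : \det (gram M) = dotv r r * \det (gram (drsubmx M')).
  by rewrite gM [in LHS]M'E [LHS]det_block_gram sqr_sqrtr ?dotvv_ge0.
by rewrite mulr_ge0 ?dotvv_ge0//= mulr_ile1// dotvv_ge0.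
Qed.

(** Both sides, multiplied by the invertible matrix D N D^T, give \det N times the identity. *)
Lemma adj_orth_conj n (D N : 'M[R]_n) : orth D -> \det N != 0 ->
  \adj (D *m N *m D^T) = D *m \adj N *m D^T.
Proof.
move=> oD dN; set A := D *m N *m D^T.
have dA : \det A = \det N by rewrite !det_mulmx det_tr mulrAC orth_det// mul1r.
have uA : A \in unitmx by rewrite unitmxE dA unitfE.
apply: (can_inj (mulKmx uA)); rewrite mul_mx_adj dA /A.
have D1 : D^T *m D = 1%:M by exact: (mulmx1C oD).
rewrite !mulmxA -(mulmxA (D *m N)) D1 mulmx1 -(mulmxA D) mul_mx_adj.
by rewrite mul_mx_scalar -scalemxAl oD scalemx1.
Qed.

Lemma pid_mxS n m d :
  pid_mx n.+1 = block_mx 1%:M 0 0 (pid_mx n) :> 'M[R]_(1 + m, 1 + d).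
Proof.
apply/matrixP => a b; rewrite !mxE.
case: (split_ordP a) => [a' ->|a' ->]; rewrite !mxE;
  case: (split_ordP b) => [b' ->|b' ->]; rewrite !mxE //=.
all: by rewrite ?(ord1 a') ?(ord1 b') ?eqn_add2l ?add1n.
Qed.

Lemma gram_usubmx m1 m2 n (M : 'M[R]_(m1 + m2, n)) :
  gram (usubmx M) = ulsubmx (gram M).
Proof. by rewrite /gram -[in RHS](vsubmxK M) tr_col_mx mul_col_row block_mxKul. Qed.

Lemma ulsubmx1 m1 m2 : ulsubmx (1%:M : 'M[R]_(m1 + m2)) = 1%:M.
Proof. by rewrite scalar_mx_block block_mxKul. Qed.

(** The factor [pid_mx n] selects the first n rows of O. Reflecting the first row of B to the first
    basis vector leaves an orthonormal family with one row and one dimension less. *)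
Lemma orthonormal_completion n d (B : 'M[R]_(n, d)) : gram B = 1%:M ->
  exists2 O : 'M[R]_d, orth O & B = pid_mx n *m O.
Proof.
elim: n d B => [|n IH] d B gB.
  by exists 1%:M; [exact: orth1|rewrite (flatmx0 B) (flatmx0 (_ *m _))].
case: d B gB => [|d] B gB.
  move: gB; rewrite /gram (thinmx0 B) mul0mx => /matrixP/(_ 0 0).
  by rewrite !mxE eqxx => /eqP; rewrite eq_sym oner_eq0.
pose r : 'rV[R]_(1 + d) := usubmx (B : 'M[R]_(1 + n, 1 + d)).
pose e : 'rV[R]_(1 + d) := row_mx 1%:M 0.
have r1 : dotv r r = 1.
  by rewrite dotvE -[LHS]/(gram r 0 0) gram_usubmx [gram _]gB ulsubmx1 mxE eqxx.
have re : dotv r r = dotv e e by rewrite r1 dotv_row dotv_scalar dot0v addr0 mulr1.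
pose H := hh r e; have oH : orth H := hh_orth _ _.
pose B' : 'M[R]_(1 + n, 1 + d) := (B : 'M[R]_(1 + n, 1 + d)) *m H.
have gB' : gram B' = 1%:M by rewrite gram_mulr.
have uB' : usubmx B' = e by rewrite -mul_usub_mx hhE.
have B'E : B' = block_mx 1%:M 0 (dlsubmx B') (drsubmx B').
  by rewrite -[LHS]submxK /ulsubmx /ursubmx uB' row_mxKl row_mxKr.
have := gB'; rewrite B'E /gram tr_block_mx mulmx_block !trmx0 trmx1 !mulmx0 !mul0mx.
rewrite !mul1mx !mulmx1 !addr0 [RHS](@scalar_mx_block _ 1 n).
move=> /eq_block_mx[_ _ l0]; rewrite l0 mul0mx add0r => gd.
have [Q oO BO] := IH _ _ gd.
have oQH : orth (block_mx 1%:M 0 0 Q *m H^T : 'M[R]_(1 + d)).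
  by apply: orthM; [apply: orth_block => //; exact: orth1|exact: orthT].
exists (block_mx 1%:M 0 0 Q *m H^T) => //.
have BE : B = block_mx 1%:M 0 0 (pid_mx n) *m (block_mx 1%:M 0 0 Q *m H^T) :> 'M[R]_(1 + n, 1 + d).
  rewrite mulmxA mulmx_block !mulmx0 !mul0mx !mul1mx !addr0 add0r -BO.
  by move: B'E; rewrite l0 => <-; rewrite -mulmxA oH mulmx1.
by rewrite [LHS]BE; congr (_ *m _); apply/esym/pid_mxS.
Qed.

(** As n < d, the last row of the completion is not a row of B, and its sign can be changed to
    correct the determinant. *)
Lemma so_completion n d (B : 'M[R]_(n, d)) : (n < d)%N -> gram B = 1%:M ->
  exists2 O : 'M[R]_d, is_SO O & B = pid_mx n *m O.
Proof.
move=> nd gB; have [Q oO BO] := orthonormal_completion gB.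
have /eqP := orth_det oO; rewrite -expr2 sqrf_eq1 => /orP[]/eqP dO.
  by exists Q.
case: d nd B gB Q oO BO dO => // d nd B gB Q oO BO dO.
pose v : 'rV[R]_d.+1 := \row_l (if l == ord_max then -1 else 1).
have oD : orth (diag_mx v).
  rewrite /orth tr_diag_mx mulmx_diag; apply/matrixP => a b; rewrite !mxE.
  by case: (a == ord_max); rewrite ?mulrNN mulr1.
exists (diag_mx v *m Q).
  split; first exact: orthM.
  rewrite det_mulmx dO det_diag (bigD1 ord_max)//= !mxE eqxx big1 ?mulr1 ?mulrNN ?mulr1//.
  by move=> l /negbTE lm; rewrite mxE lm.
rewrite BO mulmxA; congr (_ *m _); apply/matrixP => a b.
rewrite mul_mx_diag !mxE; case: eqP => //= ab; last by rewrite mul0r.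
case: eqP => [bm|_]; last by rewrite mulr1.
by have := ltn_ord a; rewrite ab bm /= ltnNge -ltnS nd.
Qed.

Lemma onb_exists n d (M : 'M[R]_(n, d)) : row_free M ->
  exists2 B : 'M[R]_(n, d), gram B = 1%:M & (B :=: M)%MS.
Proof.
elim: n M => [|n IH] M fM.
  by exists M; rewrite // (flatmx0 (gram M)) (flatmx0 1%:M).
pose v : 'rV[R]_d := usubmx (M : 'M[R]_(1 + n, d)).
pose M' : 'M[R]_(n, d) := dsubmx (M : 'M[R]_(1 + n, d)).
have ME : M = col_mx v M' :> 'M[R]_(1 + n, d) by rewrite vsubmxK.
have eM : (M :=: v + M')%MS by rewrite ME; exact/eqmx_sym/addsmxE.
have rM : \rank (v + M')%MS = n.+1 by rewrite -eM; exact/eqP.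
have rM' : \rank M' = n.
  apply/eqP; rewrite eqn_leq rank_leq_row /= -ltnS -rM.
  by rewrite (leq_trans (mxrank_adds_leqif _ _))// -[X in (_ <= X)%N]add1n leq_add2r rank_leq_row.
have [B gB BM'] := IH M' (introT eqP rM').
(* Gram-Schmidt: v minus its projection to the span of the rows already orthonormalised. *)
pose w := v - v *m B^T *m B.
have gB' : B *m B^T = 1%:M by [].
have wB : w *m B^T = 0 by rewrite mulmxBl -(mulmxA _ B) gB' mulmx1 subrr.
have w0 : w != 0.
  apply/eqP => /subr0_eq vB.
  have vM' : (v <= M')%MS by rewrite -BM' vB submxMl.
  by have := rM; rewrite (addsmx_idPr vM') rM' => /eqP; rewrite ltn_eqF.
have ww0 : 0 < dotv w w by rewrite lt_neqAle eq_sym dotvv_eq0 w0 dotvv_ge0.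
pose a := (Num.sqrt (dotv w w))^-1.
have a0 : a != 0 by rewrite invr_eq0 gt_eqF// sqrtr_gt0.
pose b := a *: w.
have bB : b *m B^T = 0 by rewrite -scalemxAl wB scaler0.
have gE : gram (col_mx b B) = 1%:M :> 'M[R]_(1 + n).
  rewrite /gram tr_col_mx mul_col_row bB -[B *m b^T]trmxK trmx_mul trmxK bB trmx0.
  rewrite gB' mulmx_dotv dotvZl dotvZr mulrA -expr2 exprVn sqr_sqrtr ?dotvv_ge0//.
  by rewrite mulVf ?gt_eqF// -scalar_mx_block.
exists (col_mx b B) => //.
have bE : (col_mx b B :=: b + B)%MS by exact/eqmx_sym/addsmxE.
suff h : (b + B == v + M')%MS.
  exact: (eqmx_trans bE (eqmx_trans (eqmxP h) (eqmx_sym eM))).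
rewrite !addsmx_sub; apply/andP; split; apply/andP; split.
- rewrite scalemx_sub// addmx_sub ?addsmxSl//.
  by rewrite -mulNmx (submx_trans (submxMl _ _))// BM' addsmxSr.
- by rewrite BM' addsmxSr.
- have -> : v = a^-1 *: b + v *m B^T *m B by rewrite scalerA mulVf// scale1r subrK.
  by apply: addmx_sub_adds; [exact: scalemx_sub|exact: submxMl].
- by rewrite -BM' addsmxSr.
Qed.

End LinearAlgebra.

(** * Generic position *)

Section Genericity.
Context {R : realType} (d : nat).
Variables (dT : measure_display) (T : measurableType dT) (P : probability T R)
  (rot : T -> 'M[R]_d).
Hypothesis haar : haar_rotation P rot.

Lemma row_free_cons n (x : 'rV[R]_d) (W : 'M[R]_(n, d)) :
  row_free W -> ~~ row_free (col_mx x W) -> (x <= W)%MS.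
Proof.
move=> fW; apply: contraR => xW; rewrite /row_free eqn_leq rank_leq_row/= -addsmxE.
have /eqP rW := fW; rewrite -[X in (1 + X <= _)%N]rW add1n; apply: rank_ltmx.
by rewrite ltmxE addsmxSr/= addsmx_sub negb_and xW.
Qed.

Lemma kernel_row n (W : 'M[R]_(n, d)) : (n < d)%N ->
  exists2 v : 'rV[R]_d, v != 0 & v *m W^T = 0.
Proof.
move=> nd; have k0 : kermx W^T != 0.
  rewrite kermx_eq0 /row_free; apply: contraTneq nd => e.
  by rewrite -leqNgt -{1}e rank_leq_col.
have /rowV0Pn[v vk v0] := k0; exists v => //.
exact/sub_kermxP.
Qed.

Lemma gram_col_mx m1 m2 (A : 'M[R]_(m1, d)) (B : 'M[R]_(m2, d)) :
  gram (col_mx A B) = block_mx (gram A) (A *m B^T) (B *m A^T) (gram B).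
Proof. by rewrite /gram tr_col_mx mul_col_row. Qed.

Lemma gram_col_mx1 m1 m2 (A : 'M[R]_(m1, d)) (B : 'M[R]_(m2, d)) :
  gram (col_mx A B) = 1%:M -> [/\ gram A = 1%:M, A *m B^T = 0 & gram B = 1%:M].
Proof. by rewrite gram_col_mx scalar_mx_block => /eq_block_mx[]. Qed.

(** For orthonormal bases of L(C) and L(D), the square root of the Gram determinant is the sine of
    L(C) and M L(D). The transpose matches [rot_set], where row vectors are multiplied by the
    transposed rotation. *)
Definition stack m1 m2 (A : 'M[R]_(m1, d)) (B : 'M[R]_(m2, d)) (M : 'M[R]_d) :=
  col_mx A (B *m M^T).

Lemma row_free_stack_cons m1 m2 (A : 'M[R]_(m1, d)) (b : 'rV[R]_d)
    (B : 'M[R]_(m2, d)) M :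
  row_free (stack A (col_mx b B) M) = row_free (col_mx (b *m M^T) (stack A B M)).
Proof.
rewrite /row_free /stack mul_col_mx -!addsmxE addnCA; congr (_ == _).
rewrite (adds_eqmx (eqmx_refl A) (eqmx_sym (addsmxE _ _))).
rewrite (adds_eqmx (eqmx_refl (b *m M^T)) (eqmx_sym (addsmxE _ _))).
by rewrite addsmxA (addsmxC A) -addsmxA.
Qed.

(** Only the new failure is recorded, the one caused by the row y itself, so that the induction over
    the rows of the rotated block adds up. *)
Definition degenerate m1 m2 (A : 'M[R]_(m1, d)) (B : 'M[R]_(m2, d)) (M : 'M[R]_d)
    (y : 'rV[R]_d) : Prop :=
  row_free (stack A B M) /\ ~~ row_free (col_mx (y *m M^T) (stack A B M)).

Lemma degenerateZ m1 m2 (A : 'M[R]_(m1, d)) (B : 'M[R]_(m2, d)) M y (a : R) :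
  a != 0 -> degenerate A B M (a *: y) <-> degenerate A B M y.
Proof.
move=> a0; rewrite /degenerate /row_free -!addsmxE -scalemxAl.
by have e := adds_eqmx (eqmx_scale (y *m M^T) a0) (eqmx_refl (stack A B M)); rewrite e.
Qed.

Local Open Scope ereal_scope.

Lemma measurable_row_free dX (X : measurableType dX) m n (M : X -> 'M[R]_(m, n)) :
  measurable_fun setT M -> measurable [set x | row_free (M x)].
Proof.
move=> mM; rewrite (_ : [set x | _] = ~` [set x | \det (gram (M x)) = 0%R]).
  apply: measurableC; apply: measurable_set_eq => //; apply: measurable_det.
  by apply: measurable_mulmx => //; exact: measurable_trmx.
by apply/seteqP; split=> x /=; rewrite -det_gram_neq0 => /eqP.
Qed.

Lemma measurable_not_row_free dX (X : measurableType dX) m n (M : X -> 'M[R]_(m, n)) :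
  measurable_fun setT M -> measurable [set x | ~~ row_free (M x)].
Proof.
move=> mM; rewrite (_ : [set x | _] = ~` [set x | row_free (M x)]).
  exact/measurableC/measurable_row_free.
by apply/seteqP; split=> x /= /negP.
Qed.

Lemma measurable_degenerate dX (X : measurableType dX) m1 m2 (A : 'M[R]_(m1, d))
    (B : 'M[R]_(m2, d)) (M : X -> 'M[R]_d) (y : X -> 'rV[R]_d) :
  measurable_fun setT M -> measurable_fun setT y ->
  measurable [set x | degenerate A B (M x) (y x)].
Proof.
move=> mM my.
have mS : measurable_fun setT (fun x => stack A B (M x)).
  apply: measurable_col_mx => //; apply: measurable_mulmx => //; exact: measurable_trmx.
apply: measurableI; first exact: measurable_row_free.
apply/measurable_not_row_free/measurable_col_mx => //.
by apply: measurable_mulmx => //; exact: measurable_trmx.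
Qed.

(** As m1 + m2 < d, some v != 0 is orthogonal to all rows of the stack. A degenerate g Pi M^T lies
    in their span, so g is orthogonal to v M Pi, which equals v M and is nonzero: a hyperplane. *)
Lemma gaussm_degenerate m1 m2 (A : 'M[R]_(m1, d)) (B : 'M[R]_(m2, d)) (M : 'M[R]_d) :
  orth M -> gram B = 1%:M -> (m1 + m2 < d)%N ->
  gaussm d [set g | degenerate A B M (g *m (1%:M - B^T *m B))] = 0.
Proof.
move=> oM gB md; pose W := stack A B M.
have gB' : B *m B^T = 1%:M by [].
set Pi := (1%:M - B^T *m B)%R.
have PiT : Pi^T = Pi by rewrite /Pi linearB/= trmx1 trmx_mul trmxK.
have [v v0 vW] := kernel_row W md.
have vB : v *m M *m B^T = 0%R.
  move: vW; rewrite /W /stack tr_col_mx mul_mx_row => /(congr1 rsubmx).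
  by rewrite row_mxKr trmx_mul trmxK mulmxA => ->; apply/matrixP => k l; rewrite !mxE.
have a0 : v *m M *m Pi != 0%R.
  rewrite mulmxBr mulmx1 mulmxA vB mul0mx subr0.
  by apply: contraNneq v0 => e; rewrite -[v]mulmx1 -oM mulmxA e mul0mx.
apply/eqP; rewrite eq_le measure_ge0 andbT -(gaussm_hyperplane a0).
apply: le_measure; rewrite ?inE.
- by apply: measurable_degenerate => //; exact: measurable_mulmxr.
- by apply: measurable_set_eq => //; exact: measurable_dotv.
- move=> g [fW /(row_free_cons fW) /submxP[c cW]] /=.
  have -> : dotv g (v *m M *m Pi) = dotv (g *m Pi *m M^T) v.
    by rewrite !dotv_mulmx trmxK PiT.
  by rewrite cW dotvC -/W -[X in dotv v (c *m X)]trmxK -dotv_mulmx vW dot0v.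
Qed.

(* The first row of B can be moved to any unit vector orthogonal to the other
   rows without changing the probability, hence to a Gaussian direction in that
   complement; for a fixed rotation the degenerate directions are null. *)
Lemma generic_stack m1 m2 (A : 'M[R]_(m1, d)) (B : 'M[R]_(m2, d)) :
  row_free A -> gram B = 1%:M -> (m1 + m2 < d)%N ->
  P [set t | ~~ row_free (stack A B (rot t))] = 0.
Proof.
move=> fA; elim: m2 B => [|m IH] B gB md.
  rewrite (_ : [set t | _] = set0) ?measure0//; apply/seteqP; split=> t //= /negP[].
  rewrite /stack /row_free -addsmxE (flatmx0 (B *m _)) addsmx0 (eqP fA).
  by rewrite addn0.
pose b : 'rV[R]_d := usubmx (B : 'M[R]_(1 + m, d)).
pose B' : 'M[R]_(m, d) := dsubmx (B : 'M[R]_(1 + m, d)).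
have BE : B = col_mx b B' :> 'M[R]_(1 + m, d) by rewrite vsubmxK.
have md' : (m1 + m < d)%N by rewrite (leq_ltn_trans _ md)// leq_add2l.
have gbB' : gram (col_mx b B') = 1%:M by rewrite -BE; exact: gB.
have [gb bB' gB'] := gram_col_mx1 gbB'.
have b1 : dotv b b = 1%R by rewrite dotvE -[LHS]/(gram b ord0 ord0) gb mxE eqxx.
have mr := measurable_rot haar.
pose Z y := [set t | degenerate A B' (rot t) y].
have mZ y : measurable (Z y) by exact: measurable_degenerate.
suff Zb : P (Z b) = 0.
  have mN : measurable [set t | ~~ row_free (stack A B' (rot t))].
    apply/measurable_not_row_free/measurable_col_mx => //.
    by apply: measurable_mulmx => //; exact: measurable_trmx.
  have mN' : measurable [set t | ~~ row_free (stack A B (rot t))].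
    apply/measurable_not_row_free/measurable_col_mx => //.
    by apply: measurable_mulmx => //; exact: measurable_trmx.
  apply/eqP; rewrite eq_le measure_ge0 andbT.
  (* Dependence for B occurs already for B', a null event by induction, or appears with the row
     b. *)
  rewrite -[X in _ <= X](adde0 0) -{1}(IH B' gB' md') -Zb.
  apply: (@le_trans _ _ (P ([set t | ~~ row_free (stack A B' (rot t))] `|` Z b))).
    apply: le_measure; rewrite ?inE//; first exact: measurableU.
    move=> t /= nf; have [fW|] := boolP (row_free (stack A B' (rot t))); last by left.
    by right; split => //; rewrite -row_free_stack_cons -BE; exact: nf.
  exact: measureU2.
(* b and y both complete B' to 1 + m < d orthonormal rows, so an element of SO_d fixes B' and
   carries b to y; right invariance concludes. *)
have pE y : dotv y y = 1%R -> y *m B'^T = 0%R -> P (Z y) = P (Z b).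
  move=> y1 yB'.
  have gE x : dotv x x = 1%R -> x *m B'^T = 0%R -> gram (col_mx x B') = 1%:M.
    move=> x1 xB'; rewrite gram_col_mx xB' -[B' *m x^T]trmxK trmx_mul trmxK xB' trmx0.
    by rewrite [gram B']gB' /gram mulmx_dotv x1 -scalar_mx_block.
  have m1d : (1 + m < d)%N by rewrite (leq_ltn_trans _ md)// leq_addl.
  have [Q1 SO1 e1] := so_completion m1d (gE _ b1 bB').
  have [Q2 SO2 e2] := so_completion m1d (gE _ y1 yB').
  have oO1 : Q1 *m Q1^T = 1%:M by case: SO1.
  have eg : col_mx b B' *m (Q1^T *m Q2) = col_mx y B'.
    by rewrite e1 mulmxA -(mulmxA _ Q1) oO1 mulmx1 e2.
  rewrite mul_col_mx in eg; have [eb eB'] := eq_col_mx eg.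
  pose g := Q2^T *m Q1.
  have gSO : is_SO g.
    case: SO1 SO2 => [oQ1 dQ1] [oQ2 dQ2]; split; first by apply: orthM => //; exact: orthT.
    by rewrite det_mulmx det_tr dQ1 dQ2 mulr1.
  rewrite -(integral_indicT P (mZ y)) -(integral_indicT P (mZ b)).
  pose h (M : 'M[R]_d) : \bar R := (\1_[set M | degenerate A B' M b] M)%:E.
  have mh : measurable_fun setT h.
    by apply/measurable_EFinP/measurable_indic; exact: measurable_degenerate.
  rewrite -[RHS](rot_right_inv haar gSO mh); last by move=> M; rewrite lee_fin.
  apply: eq_integral => t _; rewrite /h !indicE; congr ((nat_of_bool _)%:R%:E).
  apply/idP/idP; rewrite !inE /Z/= /degenerate /stack trmx_mul trmx_mul trmxK;
  by rewrite (mulmxA b) (mulmxA B') eb eB'.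
pose Pi := (1%:M - B'^T *m B')%R.
have gB'' : B' *m B'^T = 1%:M by [].
have PiT : Pi^T = Pi by rewrite /Pi linearB/= trmx1 trmx_mul trmxK.
have PiB g : g *m Pi *m B'^T = 0%R.
  by rewrite -mulmxA mulmxBl mul1mx -mulmxA gB'' mulmx1 subrr mulmx0.
have bPi : b *m Pi = b by rewrite mulmxBr mulmx1 mulmxA bB' mul0mx subr0.
have b0 : b != 0%R by rewrite -dotvv_eq0 b1 oner_eq0.
(* Degeneracy ignores nonzero factors, so g Pi may be normalised; it is nonzero because <g Pi, b> =
   <g, b>. *)
have pPi g : dotv g b != 0%R -> P (Z (g *m Pi)) = P (Z b).
  move=> gb0; set y := g *m Pi.
  have y0 : y != 0%R.
    by apply: contraNneq gb0 => y0; rewrite -bPi -PiT -dotv_mulmx -/y y0 dot0v.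
  have ny : (0 < Num.sqrt (dotv y y))%R by rewrite sqrtr_gt0 lt_neqAle eq_sym dotvv_eq0 y0 dotvv_ge0.
  rewrite -(pE ((Num.sqrt (dotv y y))^-1 *: y)%R).
  - congr (P _); apply/seteqP; split=> t /=.
      by rewrite /Z/= => /degenerateZ; apply; rewrite invr_eq0 gt_eqF.
    by rewrite /Z/= degenerateZ// invr_eq0 gt_eqF.
  - rewrite dotvZl dotvZr mulrA -expr2 exprVn sqr_sqrtr ?dotvv_ge0// mulVf//.
    by rewrite dotvv_eq0.
  - by rewrite -scalemxAl PiB scaler0.
pose h (gt : 'rV[R]_d * T) : \bar R := (\1_[set gt | degenerate A B' (rot gt.2) (gt.1 *m Pi)] gt)%:E.
have mh : measurable_fun setT h.
  apply/measurable_EFinP/measurable_indic; apply: measurable_degenerate.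
    exact: (measurableT_comp mr).
  exact: measurable_mulmx.
have h0 gt : 0 <= h gt by rewrite lee_fin.
rewrite -(integral_probability_cst (gaussm d) (measure_ge0 P (Z b))).
transitivity (\int[gaussm d]_g \int[P]_t h (g, t)).
  apply: ge0_ae_eq_integral => //.
  - exact: (measurable_fun_fubini_tonelli_F (m2 := P) _ mh h0).
  - by move=> g _; exact: integral_ge0.
  exists [set g | dotv g b = 0%R]; split; [|exact: gaussm_hyperplane|].
    by apply: measurable_set_eq => //; exact: measurable_dotv.
  move=> g /= ng; apply: contrapT => /eqP gb0; apply: ng => _.
  by rewrite -(pPi g gb0) -integral_indicT.
rewrite (fubini_tonelli (m1 := gaussm d) (m2 := P) _ mh h0).
apply: integral0_eq => t _; rewrite -[RHS](gaussm_degenerate A (_ : orth (rot t)) gB' md'); last first.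
  by case: (rot_SO haar t).
rewrite -integral_indicT//; apply: measurable_degenerate => //; exact: measurable_mulmxr.
Qed.

End Genericity.

(** * Polyhedral cones *)

Section ConeGeometry.
Context {R : realType} {d : nat}.
Implicit Types (C D S F : set 'rV[R]_d).

Lemma polyhedral0 C : polyhedral_cone C -> C 0.
Proof. by move=> [m [a ->]] l /=; rewrite dotv0. Qed.

Lemma polyhedral_scale C : polyhedral_cone C -> scale_inv C.
Proof. by move=> [m [a ->]] r x r0 h l /=; rewrite dotvZr pmulr_rle0//; exact: h. Qed.

Lemma polyhedral_measurable C dX (X : measurableType dX) (f : X -> 'rV[R]_d) :
  polyhedral_cone C -> measurable_fun setT f -> measurable [set x | C (f x)].
Proof.
move=> [m [a ->]] mf.
rewrite (_ : [set x | _] = \bigcap_(l in [set: 'I_m]) [set x | dotv (a l) (f x) <= 0]).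
  apply: fin_bigcap_measurable => // l _; apply: measurable_set_le => //.
  exact: measurable_dotv.
by apply/seteqP; split=> x /= h l; [move=> _; exact: h|exact: (h l I)].
Qed.

Lemma sub_lin_hull S x : S x -> lin_hull S x.
Proof.
move=> Sx; exists 1%N, (fun=> 1), (fun=> x); split => //.
by rewrite big_ord1 scale1r.
Qed.

Lemma lin_hull_min S m (A : 'M[R]_(m, d)) :
  (forall x, S x -> (x <= A)%MS) -> forall x, lin_hull S x -> (x <= A)%MS.
Proof.
move=> SA x [n [c [v [Sv ->]]]]; apply: summx_sub => l _.
exact/scalemx_sub/SA.
Qed.

Lemma lin_hull_perp S y :
  (forall x, S x -> dotv y x = 0) -> forall x, lin_hull S x -> dotv y x = 0.
Proof.
move=> Sy x [n [c [v [Sv ->]]]]; rewrite dotvE linear_sum/= mulmx_sumr summxE big1// => l _.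
by rewrite -dotvE dotvZr Sy// mulr0.
Qed.

Lemma lin_hull_mono S S' x : (forall y, S y -> S' y) -> lin_hull S x -> lin_hull S' x.
Proof. by move=> SS [n [c [v [Sv ->]]]]; exists n, c, v; split => // l; exact/SS/Sv. Qed.

Lemma lin_hullD S x y : lin_hull S x -> lin_hull S y -> lin_hull S (x + y).
Proof.
move=> [n [c [v [Sv ->]]]] [n' [c' [v' [Sv' ->]]]].
exists (n + n')%N,
  (fun l => match fintype.split l with inl k => c k | inr k => c' k end),
  (fun l => match fintype.split l with inl k => v k | inr k => v' k end); split.
  by move=> l; case: (fintype.split l).
rewrite big_split_ord/=; congr (_ + _); apply: eq_bigr => l _.
  by rewrite (unsplitK (inl l)).
by rewrite (unsplitK (inr l)).
Qed.

Lemma gram1_row_free n (B : 'M[R]_(n, d)) : gram B = 1%:M -> row_free B.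
Proof. by move=> gB; rewrite -det_gram_neq0 gB det1 oner_eq0. Qed.

Lemma onb_sub (L : set 'rV[R]_d) n (B : 'M[R]_(n, d)) m (A : 'M[R]_(m, d)) :
  onb L B -> (forall x, L x -> (x <= A)%MS) -> (B <= A)%MS.
Proof.
move=> [_ LB] LA; apply/row_subP => l; apply/LA/LB; exact: row_sub.
Qed.

Lemma onb_uniq (L : set 'rV[R]_d) n1 n2 (B1 : 'M[R]_(n1, d)) (B2 : 'M[R]_(n2, d)) :
  onb L B1 -> onb L B2 -> n1 = n2.
Proof.
move=> o1 o2; have f1 := gram1_row_free (proj1 o1); have f2 := gram1_row_free (proj1 o2).
have l12 : (B1 <= B2)%MS by apply: (onb_sub o1) => x /(proj2 o2).
have l21 : (B2 <= B1)%MS by apply: (onb_sub o2) => x /(proj2 o1).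
by apply/eqP; rewrite -(eqP f1) -(eqP f2) eqn_leq !mxrankS.
Qed.

Lemma onb_change (L : set 'rV[R]_d) n (B1 B2 : 'M[R]_(n, d)) :
  onb L B1 -> onb L B2 -> exists2 Q : 'M[R]_n, orth Q & B2 = Q *m B1.
Proof.
move=> o1 o2; have gB1 : B1 *m B1^T = 1%:M := proj1 o1.
have gB2 : B2 *m B2^T = 1%:M := proj1 o2.
have /submxP[X XB] : (B2 <= B1)%MS by apply: (onb_sub o2) => x /(proj2 o1).
exists X => //; move: gB2; rewrite XB trmx_mul mulmxA -(mulmxA X) gB1 mulmx1; exact.
Qed.

(** [gsine] chooses among candidate values. The branch through orthogonal complements would need n1
    + n2 >= d, and in the other one a change of orthonormal bases leaves the Gram determinant fixed,
    so there is a single candidate. *)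
Lemma gsineE (L1 L2 : set 'rV[R]_d) n1 n2 (B1 : 'M[R]_(n1, d)) (B2 : 'M[R]_(n2, d)) :
  onb L1 B1 -> onb L2 B2 -> (n1 + n2 < d)%N ->
  gsine L1 L2 = Num.sqrt (\det (gram (col_mx B1 B2))).
Proof.
move=> o1 o2 nd; rewrite /gsine; set X := [set s | _].
suff XE s : X s -> s = Num.sqrt (\det (gram (col_mx B1 B2))).
  apply: xget_subset1; last by move=> s s' /XE -> /XE ->.
  by left; exists n1, n2, B1, B2; split => //; exact: ltnW.
case=> [[m1 [m2 [A1 [A2 [a1 a2 _ ->]]]]]|[m1 [m2 [A1 [A2 [a1 a2 dm _]]]]]]; last first.
  by move: dm; rewrite (onb_uniq a1 o1) (onb_uniq a2 o2) leqNgt nd.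
have e1 := onb_uniq a1 o1; have e2 := onb_uniq a2 o2; subst m1 m2.
have [Q1 oQ1 ->] := onb_change o1 a1; have [Q2 oQ2 ->] := onb_change o2 a2.
rewrite /pvol; congr Num.sqrt.
have -> : col_mx (Q1 *m B1) (Q2 *m B2) = block_mx Q1 0 0 Q2 *m col_mx B1 B2.
  by rewrite mul_block_col !mul0mx addr0 add0r.
exact/det_gram_orthl/orth_block.
Qed.

Lemma onb_rot D n (B : 'M[R]_(n, d)) (Q : 'M[R]_d) : orth Q ->
  onb (lin_hull D) B -> onb (lin_hull (rot_set Q D)) (B *m Q^T).
Proof.
move=> oQ [gB LB]; split.
  by rewrite -[LHS]/(gram (B *m Q^T)) gram_mulr//; exact: orthT.
move=> x; split.
  apply: lin_hull_min => _ [y Dy <-]; apply: submxMr; exact/LB/sub_lin_hull.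
move=> xB; have : lin_hull D (x *m Q).
  apply/LB; move: (submxMr Q xB); rewrite -mulmxA.
  by rewrite (mulmx1C oQ) mulmx1.
move=> [m [c [v [Dv xE]]]]; exists m, c, (fun l => v l *m Q^T); split.
  by move=> l; exists (v l).
rewrite -[LHS]mulmx1 -oQ mulmxA xE mulmx_suml.
by apply: eq_bigr => l _; rewrite scalemxAl.
Qed.

Lemma gram_pid n : (n <= d)%N -> gram (pid_mx n : 'M[R]_(n, d)) = 1%:M.
Proof.
move=> nd; rewrite /gram tr_pid_mx mul_pid_mx.
by rewrite minnn (minn_idPr nd) pid_mx_1.
Qed.

Lemma onb_coord n : (n <= d)%N ->
  onb (lin_hull (coord_sub (R := R) (d := d) n)) (pid_mx n : 'M[R]_(n, d)).
Proof.
move=> nd; split; first exact: gram_pid.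
have cE x : coord_sub n x <-> (x <= (pid_mx n : 'M[R]_(n, d)))%MS.
  split=> [cx|/submxP[c ->] l nl].
    apply/submxP; exists (x *m (pid_mx n : 'M[R]_(d, n))).
    rewrite -mulmxA mul_pid_mx minnn minnn.
    apply/rowP => l; rewrite mxE (bigD1 l)//= mxE eqxx/=.
    rewrite big1 ?addr0 => [|k kl]; last first.
      by rewrite mxE (_ : (k == l :> nat) = false) ?mulr0//; exact/negbTE.
    by case: ltnP => nl; rewrite ?mulr1// cx// mul0r.
  rewrite mxE big1// => k _; rewrite mxE (_ : (k == l :> nat) = false) ?mulr0//.
  by apply/negbTE; rewrite neq_ltn (leq_trans (ltn_ord k) nl).
move=> x; split; first by apply: lin_hull_min => y /cE.
by move=> /cE; exact: sub_lin_hull.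
Qed.

Lemma gint_ge0 n (h : 'rV[R]_n -> \bar R) : (forall x, 0 <= h x)%E -> (0 <= gint h)%E.
Proof.
elim: n h => [|n IH] h h0 /=; first exact: h0.
by apply: integral_ge0 => t _; rewrite mule_ge0 ?lee_fin ?gdens_ge0// IH.
Qed.

Lemma gauss_ge0 n (A : set 'rV[R]_n) : (0 <= gauss A)%E.
Proof. by apply: gint_ge0 => x; rewrite lee_fin. Qed.

Lemma face_lin_hull S F x : face S F -> lin_hull F x -> lin_hull S x.
Proof. by move=> [y [_ ->]]; apply: lin_hull_mono => z []. Qed.

(** A face of full dimension has the linear hull of S, so its supporting functional vanishes on all
    of S. *)
Lemma kfaces_full S n (B : 'M[R]_(n, d)) : onb (lin_hull S) B -> kfaces S n = [set S].
Proof.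
move=> oB; apply/seteqP; split=> [F [fF [B' oB']]|_ ->] /=; last first.
  split; last by exists B.
  exists 0; split=> [x _|]; first by rewrite dot0v.
  by apply/seteqP; split=> [x Sx|x []//]; split => //=; rewrite dot0v.
have B'B : (B' <= B)%MS.
  by apply: (onb_sub oB') => x /(face_lin_hull fF) /(proj2 oB).
have BB' : (B <= B')%MS.
  have [_] := mxrank_leqif_sup B'B.
  by rewrite (eqP (gram1_row_free (proj1 oB))) (eqP (gram1_row_free (proj1 oB'))) eqxx => <-.
case: fF oB' => y [yS FE] oB'; apply/seteqP; split=> x; rewrite {1}FE; first by case.
move=> Sx; split => //=; apply: (@lin_hull_perp F) => [z|]; first by rewrite FE => -[].
by apply/(proj2 oB'); apply: submx_trans BB'; apply/(proj2 oB); exact: sub_lin_hull.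
Qed.

Lemma cvol_full S n (B : 'M[R]_(n, d)) : onb (lin_hull S) B ->
  cvol n S = gauss (minksum S (normal_cone S S)).
Proof.
by move=> oB; rewrite /cvol (kfaces_full oB) esum_set1// gauss_ge0.
Qed.

Lemma cvol_lowdim S n m (A : 'M[R]_(m, d)) :
  (forall x, S x -> (x <= A)%MS) -> (\rank A < n)%N -> cvol n S = 0%E.
Proof.
move=> SA rA; rewrite /cvol (_ : kfaces S n = set0) ?esum_set0//.
apply/seteqP; split=> // F [fF [B oB]].
have : (B <= A)%MS.
  by apply: (onb_sub oB) => x /(face_lin_hull fF); exact: lin_hull_min.
by move=> /mxrankS; rewrite (eqP (gram1_row_free (proj1 oB))) leqNgt rA.
Qed.

(* Up to the positive factor \det (gram M), the coordinates in the rows of M of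
   the orthogonal projection of z onto their span; cones do not see the factor. *)
Definition wmap m (M : 'M[R]_(m, d)) (z : 'rV[R]_d) : 'rV[R]_m :=
  z *m M^T *m \adj (gram M).

Lemma det_gram_ge0 m (M : 'M[R]_(m, d)) : 0 <= \det (gram M).
Proof.
have [fM|] := boolP (row_free M); last first.
  by rewrite -det_gram_neq0 negbK => /eqP ->.
have [B gB BM] := onb_exists fM.
have /submxP[X ->] : (M <= B)%MS by rewrite BM.
by rewrite gram_mull gB mulmx1 det_mulmx det_tr -expr2 sqr_ge0.
Qed.

(** S spans the row space of M, hence is its own only m-face, and S plus its normal cone consists of
    the points whose projection to that space lies in S. *)
Lemma cvol_param m (M : 'M[R]_(m, d)) (K : set 'rV[R]_m) S : row_free M -> scale_inv K ->
  (forall x, S x <-> exists2 c, K c & x = c *m M) ->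
  (forall x, (x <= M)%MS -> lin_hull S x) ->
  cvol m S = gauss [set z | K (wmap M z)].
Proof.
move=> fM cK SK hM; have [B gB BM] := onb_exists fM.
have SM x : S x -> (x <= M)%MS by move=> /SK[c _ ->]; exact: submxMl.
have oB : onb (lin_hull S) B.
  by split => // x; split=> [/(lin_hull_min SM)|]; rewrite BM//; exact: hM.
rewrite (cvol_full oB); congr gauss.
have d0 : 0 < \det (gram M) by rewrite lt_neqAle eq_sym det_gram_neq0 fM det_gram_ge0.
apply/seteqP; split=> [z [x [y [/SK[c Kc ->] [[_ nS] ->]]]]|z Kz] /=.
  have yM : y *m M^T = 0.
    apply/rowP => l; rewrite [RHS]mxE.
    have := lin_hull_perp nS (hM _ (row_sub l M)).
    by rewrite dotvE => <-; rewrite !mxE; apply: eq_bigr => k _; rewrite !mxE.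
  rewrite /wmap mulmxDl yM addr0 -(mulmxA c M) -[M *m M^T]/(gram M) -mulmxA mul_mx_adj.
  by rewrite mul_mx_scalar; exact: cK.
(* Dividing by the positive determinant recovers the true coordinates of the projection of z. *)
pose c := (\det (gram M))^-1 *: wmap M z.
have Kc : K c by apply: cK => //; rewrite invr_gt0.
exists (c *m M), (z - c *m M); split; first by apply/SK; exists c.
split; last by rewrite addrC subrK.
have nM : (z - c *m M) *m M^T = 0.
  rewrite mulmxBl -(mulmxA c) -[M *m M^T]/(gram M) /c /wmap -scalemxAl.
  rewrite -(mulmxA (z *m M^T)) mul_adj_mx.
  by rewrite mul_mx_scalar scalerA mulVf ?gt_eqF// scale1r subrr.
have nS x : S x -> dotv (z - c *m M) x = 0.
  move=> /SM /submxP[e ->].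
  have -> : dotv (z - c *m M) (e *m M) = dotv ((z - c *m M) *m M^T) e.
    by rewrite dotv_mulmx trmxK.
  by rewrite nM dot0v.
by split => [x /nS ->|].
Qed.

Local Open Scope ereal_scope.

(** Both recursions are peeled together, one coordinate per step; the coordinates left over for n =
    0 integrate to 1. *)
Lemma gaussm_marginal (n m : nat) (h : 'rV[R]_n -> \bar R) : (n <= m)%N ->
  measurable_fun setT h -> (forall x, 0 <= h x) ->
  \int[gaussm m]_z h (z *m pid_mx n) = \int[gaussm n]_x h x.
Proof.
elim: n m h => [|n IH] m h nm mh h0.
  apply: (@etrans _ _ (h 0%R)).
    rewrite -[RHS](integral_probability_cst (gaussm m) (h0 0%R)).
    by apply: eq_integral => z _; rewrite (thinmx0 (z *m _)).
  rewrite -[LHS](integral_probability_cst (gaussm 0) (h0 0%R)).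
  by apply: eq_integral => z _; rewrite (thinmx0 z).
case: m nm => // m nm.
rewrite (integral_gaussmS mh h0).
have mz : measurable_fun setT (fun z : 'rV[R]_(m.+1) => h (z *m pid_mx n.+1)).
  exact: measurable_fun_mulmxr.
apply: (etrans (integral_gaussmS mz (fun=> h0 _))).
apply: eq_integral => t _.
rewrite -[RHS](IH m (fun y => h (row_mx (\row_(_ < 1) t) y)))//; last first.
  exact: (measurable_fun_pair2 _ (measurable_cons_fun mh)).
apply: eq_integral => y _; congr h.
have e : row_mx (\row_(_ < 1) t) y *m block_mx 1%:M 0 0 (pid_mx n) =
    row_mx (\row_(_ < 1) t) (y *m pid_mx n) :> 'rV[R]_(1 + n).
  by rewrite mul_row_block !mulmx0 mulmx1 addr0 add0r.
by apply: etrans e; congr (_ *m _); exact: pid_mxS.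
Qed.

(** For an orthonormal basis, [wmap] is z B^T. Completing B to an orthogonal matrix makes these the
    first n coordinates of a rotated Gaussian, so the ambient dimension drops out. *)
Lemma cvol_coord C n (B : 'M[R]_(n, d)) : polyhedral_cone C -> onb (lin_hull C) B ->
  cvol n C = gaussm n [set u | C (u *m B)].
Proof.
move=> pC oB; have gB : gram B = 1%:M := proj1 oB.
have mK : measurable [set u | C (u *m B)].
  by apply: polyhedral_measurable => //; exact: measurable_mulmxr.
rewrite (@cvol_param _ B [set u | C (u *m B)]); last 4 first.
- exact: gram1_row_free.
- by move=> a u a0 /= Cu; rewrite -scalemxAl; exact: polyhedral_scale.
- move=> x; split=> [Cx|[c Cc ->]//].
  have /submxP[c cE] : (x <= B)%MS by apply/(proj2 oB); exact: sub_lin_hull.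
  by exists c; rewrite //= -cE.
- by move=> x /(proj2 oB).
rewrite (_ : [set z | _] = [set z | [set u | C (u *m B)] (z *m B^T)]); last first.
  by apply/seteqP; split=> z /=; rewrite /wmap gB adj1 mulmx1.
have nd : (n <= d)%N.
  by rewrite -(eqP (gram1_row_free gB)) rank_leq_col.
have [Q oQ BQ] := orthonormal_completion gB.
have BT : B^T = Q^T *m pid_mx n by rewrite BQ trmx_mul tr_pid_mx.
rewrite gaussE; last exact: measurable_preim_mulmxr.
pose A := [set z : 'rV[R]_d | [set u | C (u *m B)] (z *m pid_mx n)].
rewrite (_ : [set z | _] = [set z | A (z *m Q^T)]); last first.
  by apply/seteqP; split=> z; rewrite /A/= BT mulmxA.
rewrite gaussm_orth; [|exact: orthT|exact: measurable_preim_mulmxr].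
rewrite -!integral_indicT//; last exact: measurable_preim_mulmxr.
rewrite -(gaussm_marginal nd (h := fun u => (\1_[set u | C (u *m B)] u)%:E))//.
exact/measurable_EFinP/measurable_indic.
Qed.

End ConeGeometry.

(** * Sums of cones *)

Section SumOfCones.
Context {R : realType} {d i j : nat}.
Variables (B1 : 'M[R]_(i, d)) (B2 : 'M[R]_(j, d)).

Lemma wmap_conj m (M : 'M[R]_(m, d)) (D : 'M[R]_m) (g : 'M[R]_d) z :
  orth D -> orth g -> row_free M ->
  wmap (D *m M *m g) z = wmap M (z *m g^T) *m D^T.
Proof.
move=> oD og fM; rewrite /wmap gram_mulr// gram_mull adj_orth_conj//; last first.
  by rewrite det_gram_neq0.
have DD : D^T *m D = 1%:M by exact: (mulmx1C oD).
by rewrite !trmx_mul !mulmxA -(mulmxA _ D^T D) DD mulmx1.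
Qed.

(** g preserves the span of B1 and h that of B2; solving the first condition for B1 lets g be pulled
    out on the right of both blocks. *)
Lemma stack_act (g h Q : 'M[R]_d) (D1 : 'M[R]_i) (D2 : 'M[R]_j) M : 
  B1 = D1 *m B1 *m g -> B2 *m h^T = D2 *m B2 ->
  stack B1 B2 (g^T *m M *m h) = block_mx D1 0 0 D2 *m stack B1 B2 M *m g.
Proof.
move=> e1 e2; rewrite /stack mul_block_col !mul0mx addr0 add0r mul_col_mx -e1.
by congr col_mx; rewrite !trmx_mul trmxK (mulmxA B2) e2 !mulmxA.
Qed.

Lemma measurable_wmap_cone (C D : set 'rV[R]_d) m (M : 'M[R]_(i + j, m)) :
  polyhedral_cone C -> polyhedral_cone D ->
  measurable [set z | C (lsubmx (wmap M z) *m B1) /\ D (rsubmx (wmap M z) *m B2)].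
Proof.
move=> pC pD; have mw : measurable_fun setT (wmap M).
  by apply: measurable_mulmx => //; exact: measurable_mulmxr.
apply: measurableI.
  by apply: polyhedral_measurable => //; apply: measurable_mulmx => //; exact: measurable_lsubmx.
by apply: polyhedral_measurable => //; apply: measurable_mulmx => //; exact: measurable_rsubmx.
Qed.

(** For independent rows a point of the sum has unique coordinates, and the sum is the image of a
    product of two cones. *)
Lemma cvol_minksum (C D : set 'rV[R]_d) (Q : 'M[R]_d) :
  polyhedral_cone C -> polyhedral_cone D ->
  onb (lin_hull C) B1 -> onb (lin_hull D) B2 -> orth Q -> row_free (stack B1 B2 Q) ->
  cvol (i + j) (minksum C (rot_set Q D)) =
  gaussm d [set z | C (lsubmx (wmap (stack B1 B2 Q) z) *m B1) /\
                    D (rsubmx (wmap (stack B1 B2 Q) z) *m B2)].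
Proof.
move=> pC pD o1 o2 oQ fW; set W := stack B1 B2 Q.
have WE c : c *m W = lsubmx c *m B1 + rsubmx c *m B2 *m Q^T.
  by rewrite -{1}(hsubmxK c) /W /stack mul_row_col mulmxA.
rewrite (@cvol_param _ _ _ W [set c | C (lsubmx c *m B1) /\ D (rsubmx c *m B2)])//.
- by rewrite gaussE//; exact: measurable_wmap_cone.
- move=> a c a0 [Cc Dc]; split; rewrite linearZ/= -scalemxAl; exact: polyhedral_scale.
- move=> x; split=> [[y [_ [Cy [[z Dz <-] ->]]]]|[c [Cc Dc] ->]]; last first.
    by rewrite WE; exists (lsubmx c *m B1), (rsubmx c *m B2 *m Q^T); split => //; split => //;
      exists (rsubmx c *m B2).
  have /submxP[a aE] : (y <= B1)%MS by apply/(proj2 o1); exact: sub_lin_hull.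
  have /submxP[b bE] : (z <= B2)%MS by apply/(proj2 o2); exact: sub_lin_hull.
  exists (row_mx a b); first by rewrite /= row_mxKl row_mxKr -aE -bE.
  by rewrite WE row_mxKl row_mxKr -aE -bE.
- move=> _ /submxP[c ->]; rewrite WE; apply: lin_hullD.
    apply: (@lin_hull_mono _ _ C) => [y Cy|]; last by apply/(proj2 o1); exact: submxMl.
    exists y, 0; split => //; split; last by rewrite addr0.
    by exists 0; rewrite ?mul0mx//; exact: polyhedral0.
  apply: (@lin_hull_mono _ _ (rot_set Q D)) => [y Dy|].
    by exists 0, y; split; [exact: polyhedral0|split; rewrite ?add0r].
  by apply/(proj2 (onb_rot oQ o2)); rewrite -mulmxA; exact: submxMl.
Qed.

(** The sum then spans fewer than i + j dimensions and has no face of that dimension. *)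
Lemma cvol_minksum0 (C D : set 'rV[R]_d) (Q : 'M[R]_d) :
  onb (lin_hull C) B1 -> onb (lin_hull D) B2 -> ~~ row_free (stack B1 B2 Q) ->
  cvol (i + j) (minksum C (rot_set Q D)) = 0%E.
Proof.
move=> o1 o2 nf; apply: (@cvol_lowdim _ _ _ _ _ (stack B1 B2 Q)); last first.
  by rewrite ltn_neqAle rank_leq_row andbT.
move=> x [y [_ [Cy [[z Dz <-] ->]]]]; rewrite -addsmxE addmx_sub_adds//.
  by apply/(proj2 o1); exact: sub_lin_hull.
by apply: submxMr; apply/(proj2 o2); exact: sub_lin_hull.
Qed.

Lemma stack_det_bounds (Q : 'M[R]_d) : orth Q -> gram B1 = 1%:M -> gram B2 = 1%:M ->
  0 <= \det (gram (stack B1 B2 Q)) <= 1.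
Proof.
move=> oQ g1 g2; apply: det_gram_bounds => l.
have gr m (B : 'M[R]_(m, d)) (k : 'I_m) : gram B = 1%:M -> dotv (row k B) (row k B) = 1.
  move=> gB; have <- : gram B k k = 1 by rewrite gB mxE eqxx.
  by rewrite /gram mxE; apply: eq_bigr => e _; rewrite !mxE.
rewrite /stack; case: (split_ordP l) => k ->.
  by rewrite rowKu gr.
by rewrite rowKd gr// gram_mulr//; exact: orthT.
Qed.

End SumOfCones.

(** * Cone averages over a Haar rotation and an independent Gaussian *)

Section HaarConeAverage.
Context {R : realType} (d : nat).
Variables (dT : measure_display) (T : measurableType dT) (P : probability T R)
  (rot : T -> 'M[R]_d).
Hypothesis haar : haar_rotation P rot.
Local Open Scope ereal_scope.

(** Haar invariance under M -> g M h and Gaussian invariance under a together give the invariance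
    asked by [cone_average]. U has to transform only where F is nonzero, because [wmap] is
    equivariant for independent rows only. *)
Lemma haar_cone_average n (K : set 'rV[R]_n) (U : 'M[R]_d * 'rV[R]_d -> 'rV[R]_n)
    (F : 'M[R]_d * 'rV[R]_d -> \bar R) :
  measurable K -> scale_inv K -> K 0%R ->
  measurable_fun setT F -> (forall x, 0 <= F x) -> measurable_fun setT U ->
  (forall Q, orth Q -> exists g h a : 'M[R]_d, [/\ is_SO g, is_SO h, orth a &
    forall M z, F (g *m M *m h, z) = F (M, z *m a) /\
      (F (M, z *m a) = 0 \/ U (g *m M *m h, z) = U (M, z *m a) *m Q)]) ->
  ((0 < n)%N -> (P \x gaussm d).-negligible [set tz | U (rot tz.1, tz.2) = 0%R]) ->
  \int[P]_t \int[gaussm d]_z (F (rot t, z) * (\1_K (U (rot t, z)))%:E) =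
  gaussm n K * \int[P]_t \int[gaussm d]_z F (rot t, z).
Proof.
move=> mK cK K0 mF F0 mU inv U0.
have mr := measurable_rot haar.
have mI : measurable_fun setT (fun x : 'rV[R]_n => (\1_K x : R)%:E).
  exact/measurable_EFinP/measurable_indic.
have mrz : measurable_fun setT (fun tz : T * 'rV[R]_d => (rot tz.1, tz.2)).
  by apply/measurable_fun_pair => //; exact: (measurableT_comp mr).
have mFr : measurable_fun setT (fun tz : T * 'rV[R]_d => F (rot tz.1, tz.2)).
  exact: (measurableT_comp mF mrz).
have mUr : measurable_fun setT (fun tz : T * 'rV[R]_d => U (rot tz.1, tz.2)).
  exact: (measurableT_comp mU mrz).
have I0 x : 0 <= (\1_K x : R)%:E by rewrite lee_fin.
have mFU Q : measurable_fun setT (fun x => F x * (\1_K (U x *m Q) : R)%:E).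
  apply: emeasurable_funM => //; apply: (measurableT_comp mI).
  exact: measurable_mulmx.
have mFUr Q : measurable_fun setT
    (fun tz : T * 'rV[R]_d => F (rot tz.1, tz.2) * (\1_K (U (rot tz.1, tz.2) *m Q) : R)%:E).
  exact: (measurableT_comp (mFU Q) mrz).
have FU0 x Q : 0 <= F x * (\1_K (U x *m Q) : R)%:E by rewrite mule_ge0.
have fub Q : \int[P \x gaussm d]_tz (F (rot tz.1, tz.2) * (\1_K (U (rot tz.1, tz.2) *m Q))%:E)
   = \int[P]_t \int[gaussm d]_z (F (rot t, z) * (\1_K (U (rot t, z) *m Q))%:E).
  exact: (fubini_tonelli1 (m1 := P) (m2 := gaussm d) _ (mFUr Q) (fun=> FU0 _ _)).
have invI Q : orth Q ->
  \int[P]_t \int[gaussm d]_z (F (rot t, z) * (\1_K (U (rot t, z) *m Q))%:E) =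
  \int[P]_t \int[gaussm d]_z (F (rot t, z) * (\1_K (U (rot t, z) *m 1%:M))%:E).
  move=> oQ; have [g [h [a [gSO hSO oa gha]]]] := inv Q oQ.
  pose k (M : 'M[R]_d) := \int[gaussm d]_z (F (M, z) * (\1_K (U (M, z) *m 1%:M))%:E).
  have mk : measurable_fun setT k.
    exact: (measurable_fun_fubini_tonelli_F (m2 := gaussm d) _ (mFU 1%:M) (fun=> FU0 _ _)).
  have k0 M : 0 <= k M by exact: integral_ge0.
  have mkh : measurable_fun setT (fun M => k (M *m h)).
    by apply: (measurableT_comp mk); exact: measurable_mulmx.
  have e1 := rot_right_inv haar hSO mk k0.
  have e2 := rot_left_inv haar gSO mkh (fun=> k0 _).
  apply/esym; apply: (etrans (esym e1)); apply: (etrans (esym e2)).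
  apply: eq_integral => t _; rewrite /k.
  have mz : measurable_fun setT (fun z => F (rot t, z) * (\1_K (U (rot t, z) *m Q) : R)%:E).
    exact: (measurable_fun_pair2 (rot t) (mFU Q)).
  rewrite -[RHS](gauss_orth oa mz (fun=> FU0 _ _)).
  apply: eq_integral => z _; have [-> FU] := gha (rot t) z.
  case: FU => [F0z|->]; last by rewrite mulmx1.
  by rewrite F0z !mul0e.
transitivity (\int[P \x gaussm d]_tz (F (rot tz.1, tz.2) * (\1_K (U (rot tz.1, tz.2)))%:E)).
  apply: (etrans _ (etrans (esym (fub 1%:M)) _)).
    by apply: eq_integral => t _; apply: eq_integral => z _; rewrite mulmx1.
  by apply: eq_integral => tz _; rewrite mulmx1.
have invX Q : orth Q ->
  \int[P \x gaussm d]_tz (F (rot tz.1, tz.2) * (\1_K (U (rot tz.1, tz.2) *m Q))%:E) =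
  \int[P \x gaussm d]_tz (F (rot tz.1, tz.2) * (\1_K (U (rot tz.1, tz.2)))%:E).
  move=> oQ; apply: (etrans (fub Q)); apply: (etrans (invI _ oQ)).
  apply: (etrans (esym (fub 1%:M))).
  by apply: eq_integral => tz _; rewrite mulmx1.
have ca : \int[P \x gaussm d]_tz (F (rot tz.1, tz.2) * (\1_K (U (rot tz.1, tz.2)))%:E) =
    gaussm n K * \int[P \x gaussm d]_tz F (rot tz.1, tz.2).
  exact: (cone_average (m := (P \x gaussm d : probability _ R)) mK cK K0 mFr
    (fun=> F0 _) mUr invX U0).
rewrite ca; congr (_ * _).
exact: (fubini_tonelli1 (m1 := P) (m2 := gaussm d) _ mFr (fun=> F0 _)).
Qed.

End HaarConeAverage.

(** * Factorisation of the weighted integral *)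

Section SineIntegral.
Context {R : realType} {d i j : nat}.
Variables (dT : measure_display) (T : measurableType dT) (P : probability T R)
  (rot : T -> 'M[R]_d).
Hypothesis haar : haar_rotation P rot.
Variables (B1 : 'M[R]_(i, d)) (B2 : 'M[R]_(j, d)).
Hypotheses (gB1 : gram B1 = 1%:M) (gB2 : gram B2 = 1%:M) (ijd : (i + j < d)%N).

Let W (M : 'M[R]_d) := stack B1 B2 M.

(** B and Q B are both completed to elements of SO_d, whose quotient is g; n < d leaves room to
    offset \det Q = -1. *)
Lemma so_act n (B : 'M[R]_(n, d)) (Q : 'M[R]_n) : (n < d)%N -> gram B = 1%:M ->
  orth Q -> exists2 g : 'M[R]_d, is_SO g & B *m g = Q *m B.
Proof.
move=> nd gB oQ; have gQB : gram (Q *m B) = 1%:M by rewrite gram_mull gB mulmx1.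
have [Q1 SO1 e1] := so_completion nd gB; have [Q2 SO2 e2] := so_completion nd gQB.
have oQ1 : Q1 *m Q1^T = 1%:M by case: SO1.
exists (Q1^T *m Q2).
  case: SO1 SO2 => [_ d1] [oQ2 d2]; split; first by apply: orthM => //; exact: orthT.
  by rewrite det_mulmx det_tr d1 d2 mulr1.
by rewrite e2 {1}e1 mulmxA -(mulmxA _ Q1) oQ1 mulmx1.
Qed.

Lemma is_SO1 : is_SO (1%:M : 'M[R]_d).
Proof. by split; [exact: orth1|rewrite det1]. Qed.

Let u (x : 'M[R]_d * 'rV[R]_d) := lsubmx (wmap (W x.1) x.2).
Let v (x : 'M[R]_d * 'rV[R]_d) := rsubmx (wmap (W x.1) x.2).
Let sine (M : 'M[R]_d) := Num.sqrt (\det (gram (W M))).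

Lemma measurable_stack : measurable_fun setT W.
Proof. by apply: measurable_col_mx => //; apply: measurable_mulmx => //; exact: measurable_trmx. Qed.

Lemma measurable_sine : measurable_fun setT sine.
Proof.
apply: measurable_sqrt; apply: measurable_det; apply: measurable_mulmx.
  exact: measurable_stack.
by apply: measurable_trmx; exact: measurable_stack.
Qed.

Lemma measurable_wmap_stack :
  measurable_fun setT (fun x : 'M[R]_d * 'rV[R]_d => wmap (W x.1) x.2).
Proof.
have mW : measurable_fun setT (fun x : 'M[R]_d * 'rV[R]_d => W x.1).
  exact: (measurableT_comp measurable_stack).
apply: measurable_mulmx.
  by apply: measurable_mulmx => //; exact: measurable_trmx.
by apply: measurable_adj; apply: measurable_mulmx => //; exact: measurable_trmx.
Qed.

Lemma measurable_u : measurable_fun setT u.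
Proof. by apply: measurable_lsubmx; exact: measurable_wmap_stack. Qed.

Lemma measurable_v : measurable_fun setT v.
Proof. by apply: measurable_rsubmx; exact: measurable_wmap_stack. Qed.

Local Open Scope ereal_scope.

(** Gives the absence of mass at the origin for u and v: if one coordinate is almost surely nonzero,
    so is the vector. *)
Lemma wmap_entry_null (l : 'I_(i + j)) :
  (P \x gaussm d).-negligible [set tz | wmap (W (rot tz.1)) tz.2 ord0 l = 0%R].
Proof.
have mr := measurable_rot haar.
have mrz : measurable_fun setT (fun tz : T * 'rV[R]_d => (rot tz.1, tz.2)).
  by apply/measurable_fun_pair => //; exact: (measurableT_comp mr).
pose S := [set tz : T * 'rV[R]_d | wmap (W (rot tz.1)) tz.2 ord0 l = 0%R].
have mS : measurable S.
  apply: measurable_set_eq => //; apply: measurable_entry_comp.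
  exact: (measurableT_comp measurable_wmap_stack mrz).
exists S; split => //.
have mI : measurable_fun setT (fun tz : T * 'rV[R]_d => (\1_S tz : R)%:E).
  exact/measurable_EFinP/measurable_indic.
have I0 (tz : T * 'rV[R]_d) : 0 <= (\1_S tz : R)%:E by rewrite lee_fin.
have e1 : (P \x gaussm d) S = \int[P \x gaussm d]_tz (\1_S tz)%:E.
  by rewrite integral_indicT.
rewrite e1; apply: (etrans (fubini_tonelli1 (m1 := P) (m2 := gaussm d) _ mI I0)).
rewrite -[RHS](integral_probability_cst P (lexx 0)).
apply: ge0_ae_eq_integral => //.
- exact: (measurable_fun_fubini_tonelli_F (m2 := gaussm d) _ mI I0).
- by move=> t _; exact: integral_ge0.
exists [set t | ~~ row_free (W (rot t))]; split.
- by apply: measurable_not_row_free; exact: (measurableT_comp measurable_stack mr).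
- by apply: (generic_stack haar) => //; exact: gram1_row_free.
move=> t /= nt; apply/negP => fW; apply: nt => _.
(* The l-th coordinate of [wmap] is the linear form in z given by column l of X. As W X is the Gram
   determinant times the identity, this column is nonzero for independent rows. *)
pose X := (W (rot t))^T *m \adj (gram (W (rot t))).
pose a : 'rV[R]_d := row l X^T.
have aE z : wmap (W (rot t)) z ord0 l = dotv z a.
  by rewrite /wmap -mulmxA mxE; apply: eq_bigr => k _; rewrite !mxE.
have a0 : a != 0%R.
  apply/eqP => a0; have := fW; rewrite -det_gram_neq0 => /eqP; apply.
  have : (W (rot t) *m X) l l = \det (gram (W (rot t))).
    by rewrite /X mulmxA mul_mx_adj mxE eqxx mulr1n.
  move=> <-; rewrite mxE big1// => k _.
  by have := congr1 (fun y : 'rV[R]_d => y ord0 k) a0; rewrite !mxE => ->; rewrite mulr0.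
rewrite -[RHS](gaussm_hyperplane a0) -integral_indicT; last first.
  by apply: measurable_set_eq => //; exact: measurable_dotv.
apply: eq_integral => z _; rewrite !indicE; congr ((nat_of_bool _)%:R%:E).
by apply/idP/idP; rewrite !inE /S/= aE.
Qed.

Variable f : R -> R.
Hypotheses (mf : measurable_fun setT f) (f0 : forall x, (0 <= f x)%R).

(** The indicator makes the weight vanish where equivariance of u and v could fail; by
    [generic_stack] it changes no integral. *)
Let wt (M : 'M[R]_d) : \bar R :=
  (f (sine M))%:E * (\1_[set M | row_free (W M)] M)%:E.

Lemma wt_ge0 M : 0 <= wt M. Proof. by rewrite mule_ge0 ?lee_fin. Qed.

Lemma measurable_wt : measurable_fun setT wt.
Proof.
apply: emeasurable_funM; apply/measurable_EFinP.
  exact: (measurableT_comp mf measurable_sine).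
by apply: measurable_indic; apply: measurable_row_free; exact: measurable_stack.
Qed.

(** Orthogonal factors leave the Gram determinant alone, and the block-diagonal one acts on [wmap]
    block by block: u sees D1 only, v sees D2 only. *)
Lemma act_stack (D1 : 'M[R]_i) (D2 : 'M[R]_j) (g h M : 'M[R]_d) z :
  orth D1 -> orth D2 -> orth g ->
  B1 = D1 *m B1 *m g -> B2 *m h^T = D2 *m B2 ->
  wt (g^T *m M *m h) = wt M /\
  (wt M = 0 \/ u (g^T *m M *m h, z) = u (M, z *m g^T) *m D1^T /\
               v (g^T *m M *m h, z) = v (M, z *m g^T) *m D2^T).
Proof.
move=> o1 o2 og e1 e2.
have WE : W (g^T *m M *m h) = block_mx D1 0 0 D2 *m W M *m g by exact: stack_act.
have oD : orth (block_mx D1 0 0 D2) by exact: orth_block.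
have dE : \det (gram (W (g^T *m M *m h))) = \det (gram (W M)).
  by rewrite WE gram_mulr// det_gram_orthl.
have fE : row_free (W (g^T *m M *m h)) = row_free (W M).
  by rewrite -!det_gram_neq0 dE.
split; first by rewrite /wt /sine dE !indicE; congr (_ * (nat_of_bool _)%:R%:E); apply/idP/idP; rewrite !inE/= fE.
have [fW|nW] := boolP (row_free (W M)); last first.
  by left; rewrite /wt indicE memNset ?mule0//=; exact/negP.
right; rewrite /u /v/= WE wmap_conj// tr_block_mx !trmx0.
rewrite -(hsubmxK (wmap (W M) (z *m g^T))) mul_row_block !mulmx0 addr0 add0r.
by rewrite !row_mxKl !row_mxKr.
Qed.

Variables (K1 : set 'rV[R]_i) (K2 : set 'rV[R]_j).
Hypotheses (mK1 : measurable K1) (mK2 : measurable K2).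
Hypotheses (cK1 : scale_inv K1) (cK2 : scale_inv K2).
Hypotheses (K10 : K1 0%R) (K20 : K2 0%R).

(* Two applications of [haar_cone_average]: left multiplications preserving the
   span of B1 rotate u, right multiplications preserving that of B2 rotate v. *)
Lemma sine_integral :
  \int[P]_t \int[gaussm d]_z (wt (rot t) * (\1_K2 (v (rot t, z)))%:E *
                              (\1_K1 (u (rot t, z)))%:E) =
  gaussm i K1 * (gaussm j K2 * \int[P]_t (f (sine (rot t)))%:E).
Proof.
have mr := measurable_rot haar.
have mwt1 : measurable_fun setT (fun x : 'M[R]_d * 'rV[R]_d => wt x.1).
  exact: (measurableT_comp measurable_wt).
have mv := measurable_v; have mu := measurable_u.
have id' : (i < d)%N by rewrite (leq_ltn_trans _ ijd)// leq_addr.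
have jd' : (j < d)%N by rewrite (leq_ltn_trans _ ijd)// leq_addl.
pose F (x : 'M[R]_d * 'rV[R]_d) := wt x.1 * (\1_K2 (v x))%:E.
have mF : measurable_fun setT F.
  apply: emeasurable_funM => //.
  by apply/measurable_EFinP; exact: (measurableT_comp (measurable_indic mK2) mv).
have F0 x : 0 <= F x by rewrite mule_ge0 ?wt_ge0 ?lee_fin.
rewrite (haar_cone_average haar (U := u) mK1 cK1 K10 mF F0 mu); last 2 first.
(* Here D1 = Q^T, D2 = 1 and z moves along by g^T: u is rotated by Q, while v, whose indicator is
   part of F, stays fixed. *)
- move=> Q oQ; have [g gSO gE] := so_act id' gB1 oQ.
  have og : orth g by case: gSO.
  exists g^T, 1%:M, g^T; split; [exact: is_SO_T|exact: is_SO1|exact: orthT|].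
  move=> M z.
  have [| |wE wuv] := @act_stack Q^T 1%:M g 1%:M M z (orthT oQ) (orth1 _) og.
  + have QQ : Q^T *m Q = 1%:M by exact: (mulmx1C oQ).
    by rewrite -mulmxA gE mulmxA QQ mul1mx.
  + by rewrite trmx1 mulmx1 mul1mx.
  rewrite /F/= wE; case: wuv => [->|[uE vE]]; first by rewrite !mul0e; split; [|left].
  by split; [rewrite vE trmx1 mulmx1|right; rewrite uE trmxK].
- move=> i0; apply: negligibleS (wmap_entry_null (lshift j (Ordinal i0))) => -[t z] /= u0.
  have := congr1 (fun y : 'rV[R]_i => y ord0 (Ordinal i0)) u0.
  by rewrite /u !mxE.
congr (_ * _).
rewrite (haar_cone_average haar (U := v) (F := fun x => wt x.1) mK2 cK2 K20 mwt1 (fun=> wt_ge0 _) mv); last 2 first.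
(* Now D1 = 1 and D2 = Q^T: the rotation acts on the right of M, so z needs no compensation. *)
- move=> Q oQ; have [g gSO gE] := so_act jd' gB2 (orthT oQ).
  exists 1%:M, g^T, 1%:M; split; [exact: is_SO1|exact: is_SO_T|exact: orth1|].
  move=> M z.
  have [| |wE wuv] := @act_stack 1%:M Q^T 1%:M g^T M z (orth1 _) (orthT oQ) (orth1 _).
  + by rewrite mul1mx mulmx1.
  + by rewrite trmxK.
  rewrite trmx1 in wE wuv; rewrite /= wE; split => //.
  by case: wuv => [->|[_ vE]]; [left|right; rewrite vE trmxK].
- move=> j0; apply: negligibleS (wmap_entry_null (rshift i (Ordinal j0))) => -[t z] /= v0.
  have := congr1 (fun y : 'rV[R]_j => y ord0 (Ordinal j0)) v0.
  by rewrite /v !mxE.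
(* Off the null set of dependent stacks the weight is f of the sine, constant in z. *)
congr (_ * _); apply: ge0_ae_eq_integral => //.
- under eq_fun do rewrite (integral_probability_cst (gaussm d) (wt_ge0 _)).
  exact: (measurableT_comp measurable_wt mr).
- by apply/measurable_EFinP; apply: (measurableT_comp mf); exact: (measurableT_comp measurable_sine mr).
- by move=> t _; apply: integral_ge0 => z _; exact: wt_ge0.
- by move=> t _; rewrite lee_fin.
exists [set t | ~~ row_free (W (rot t))]; split.
- by apply: measurable_not_row_free; exact: (measurableT_comp measurable_stack mr).
- by apply: (generic_stack haar) => //; exact: gram1_row_free.
move=> t /= nt; apply/negP => fW; apply: nt => _.
rewrite (integral_probability_cst (gaussm d) (wt_ge0 _)) /wt indicE mem_set//= mule1//.
Qed.

Lemma measurable_sine_integrand :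
  measurable_fun setT (fun t => \int[gaussm d]_z (wt (rot t) * (\1_K2 (v (rot t, z)))%:E *
                              (\1_K1 (u (rot t, z)))%:E)).
Proof.
have mr := measurable_rot haar.
have mrz : measurable_fun setT (fun tz : T * 'rV[R]_d => (rot tz.1, tz.2)).
  by apply/measurable_fun_pair => //; exact: (measurableT_comp mr).
have mG : measurable_fun setT (fun tz : T * 'rV[R]_d =>
    wt (rot tz.1) * (\1_K2 (v (rot tz.1, tz.2)) : R)%:E * (\1_K1 (u (rot tz.1, tz.2)) : R)%:E).
  apply: emeasurable_funM; first apply: emeasurable_funM.
  - exact: (measurableT_comp measurable_wt (measurableT_comp mr measurable_fst)).
  - apply/measurable_EFinP; apply: (measurableT_comp (measurable_indic mK2)).
    exact: (measurableT_comp measurable_v mrz).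
  - apply/measurable_EFinP; apply: (measurableT_comp (measurable_indic mK1)).
    exact: (measurableT_comp measurable_u mrz).
apply: (measurable_fun_fubini_tonelli_F (m2 := gaussm d) _ mG) => tz.
by rewrite !mule_ge0 ?wt_ge0 ?lee_fin.
Qed.

End SineIntegral.

(** * The identity for nonnegative f *)

Section RotationSum.
Context {R : realType} {d i j : nat}.
Variables (dT : measure_display) (T : measurableType dT) (P : probability T R)
  (rot : T -> 'M[R]_d).
Hypothesis haar : haar_rotation P rot.
Hypothesis ijd : (i + j < d)%N.
Local Open Scope ereal_scope.

Definition sine_of m n (B1 : 'M[R]_(m, d)) (B2 : 'M[R]_(n, d)) (M : 'M[R]_d) : R :=
  Num.sqrt (\det (gram (stack B1 B2 M))).

(** With Q1, Q2 in SO_d completing B1, B2, the sine at M for these bases is the coordinate sine at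
    Q1 M Q2^T; two-sided invariance makes its law depend on i and j only. *)
Lemma sine_law (f : R -> R) (B1 : 'M[R]_(i, d)) (B2 : 'M[R]_(j, d)) :
  measurable_fun setT f -> (forall x, (0 <= f x)%R) ->
  gram B1 = 1%:M -> gram B2 = 1%:M ->
  \int[P]_t (f (sine_of B1 B2 (rot t)))%:E =
  \int[P]_t (f (sine_of (pid_mx i : 'M[R]_(i, d)) (pid_mx j : 'M[R]_(j, d)) (rot t)))%:E.
Proof.
move=> mf f0 gB1 gB2.
have id' : (i < d)%N by rewrite (leq_ltn_trans _ ijd)// leq_addr.
have jd' : (j < d)%N by rewrite (leq_ltn_trans _ ijd)// leq_addl.
have [Q1 SO1 e1] := so_completion id' gB1; have [Q2 SO2 e2] := so_completion jd' gB2.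
pose h (M : 'M[R]_d) := (f (sine_of (pid_mx i : 'M[R]_(i, d)) (pid_mx j : 'M[R]_(j, d)) M))%:E.
have mh : measurable_fun setT h.
  apply/measurable_EFinP; apply: (measurableT_comp mf).
  exact: (measurable_sine (pid_mx i) (pid_mx j)).
have h0 M : 0 <= h M by rewrite lee_fin.
have mhr : measurable_fun setT (fun M => h (M *m Q2^T)).
  by apply: (measurableT_comp mh); exact: measurable_mulmx.
have SO2T := is_SO_T SO2.
apply: (etrans _ (etrans (rot_left_inv haar SO1 mhr (fun=> h0 _)) (rot_right_inv haar SO2T mh h0))).
apply: eq_integral => t _; rewrite /h /sine_of; congr (f (Num.sqrt (\det _)))%:E.
have oQ1 : orth Q1 by case: SO1.
rewrite -[RHS](gram_mulr _ oQ1) /stack; congr gram.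
rewrite mul_col_mx -e1; congr col_mx; rewrite {1}e2 !trmx_mul trmxK.
by rewrite -!mulmxA (mulmx1C oQ1) mulmx1.
Qed.

Variables (C D : set 'rV[R]_d) (B1 : 'M[R]_(i, d)) (B2 : 'M[R]_(j, d)).
Hypotheses (pC : polyhedral_cone C) (pD : polyhedral_cone D).
Hypotheses (oC : onb (lin_hull C) B1) (oD : onb (lin_hull D) B2).

Lemma gsineC_rot t : gsineC C (rot_set (rot t) D) = sine_of B1 B2 (rot t).
Proof.
have oQ : orth (rot t) by case: (rot_SO haar t).
by rewrite /gsineC (gsineE oC (onb_rot oQ oD)).
Qed.

Lemma cij_sine (f : R -> R) :
  cij P rot i j f =
  \int[P]_t (f (sine_of (pid_mx i : 'M[R]_(i, d)) (pid_mx j : 'M[R]_(j, d)) (rot t)))%:E.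
Proof.
apply: eq_integral => t _; congr (f _)%:E.
have oQ : orth (rot t) by case: (rot_SO haar t).
have id' : (i <= d)%N by rewrite (leq_trans _ (ltnW ijd))// leq_addr.
have jd' : (j <= d)%N by rewrite (leq_trans _ (ltnW ijd))// leq_addl.
by rewrite /gsineC (gsineE (onb_coord id') (onb_rot oQ (onb_coord jd'))).
Qed.

Lemma sine_of_bounds t : (0 <= sine_of B1 B2 (rot t) <= 1)%R.
Proof.
have oQ : orth (rot t) by case: (rot_SO haar t).
have /andP[d0 d1] := stack_det_bounds oQ (proj1 oC) (proj1 oD).
by rewrite sqrtr_ge0/= -[X in (_ <= X)%R]sqrtr1 ler_wsqrtr.
Qed.

Lemma cvol_rot_bounds t :
  0 <= cvol (i + j) (minksum C (rot_set (rot t) D)) <= 1.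
Proof.
have oQ : orth (rot t) by case: (rot_SO haar t).
have [fW|nW] := boolP (row_free (stack B1 B2 (rot t))); last first.
  by rewrite (cvol_minksum0 oC oD nW) lexx lee_fin ler01.
rewrite (cvol_minksum pC pD oC oD oQ fW) measure_ge0 probability_le1//.
exact: measurable_wmap_cone.
Qed.

(** Measurability is part of the conclusion because it becomes visible only after the integrand is
    rewritten as a Gaussian integral, and the signed case needs it for integrability. *)
Lemma rotation_sum_ge0 (f : R -> R) :
  measurable_fun setT f -> (forall x, (0 <= f x)%R) ->
  measurable_fun setT (fun t => cvol (i + j) (minksum C (rot_set (rot t) D)) *
                                (f (gsineC C (rot_set (rot t) D)))%:E) /\
  \int[P]_t (cvol (i + j) (minksum C (rot_set (rot t) D)) *
             (f (gsineC C (rot_set (rot t) D)))%:E) =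
  cij P rot i j f * cvol i C * cvol j D.
Proof.
move=> mf f0.
have gB1 : gram B1 = 1%:M := proj1 oC; have gB2 : gram B2 = 1%:M := proj1 oD.
pose K1 := [set c | C (c *m B1)]; pose K2 := [set c | D (c *m B2)].
have mK1 : measurable K1.
  by apply: polyhedral_measurable => //; exact: measurable_mulmxr.
have mK2 : measurable K2.
  by apply: polyhedral_measurable => //; exact: measurable_mulmxr.
have cK1 : scale_inv K1.
  by move=> a x a0 /= Cx; rewrite /K1/= -scalemxAl; exact: polyhedral_scale.
have cK2 : scale_inv K2.
  by move=> a x a0 /= Cx; rewrite /K2/= -scalemxAl; exact: polyhedral_scale.
have K10 : K1 0%R by rewrite /K1/= mul0mx; exact: polyhedral0.
have K20 : K2 0%R by rewrite /K2/= mul0mx; exact: polyhedral0.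
pose G t := \int[gaussm d]_z ((f (sine_of B1 B2 (rot t)))%:E *
    (\1_[set M | row_free (stack B1 B2 M)] (rot t))%:E *
    (\1_K2 (rsubmx (wmap (stack B1 B2 (rot t)) z)))%:E *
    (\1_K1 (lsubmx (wmap (stack B1 B2 (rot t)) z)))%:E).
(* This holds for every t: for dependent stacks both sides vanish. *)
have GE : (fun t => cvol (i + j) (minksum C (rot_set (rot t) D)) *
                    (f (gsineC C (rot_set (rot t) D)))%:E) = G.
  apply/funext => t; rewrite gsineC_rot /G.
  have oQ : orth (rot t) by case: (rot_SO haar t).
  have [fW|nW] := boolP (row_free (stack B1 B2 (rot t))); last first.
    rewrite (cvol_minksum0 oC oD nW) mul0e integral0_eq// => z _.
    by rewrite [X in _ * X * _ * _](_ : _ = 0) ?mule0 ?mul0e// indicE memNset//=; exact/negP.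
  rewrite (cvol_minksum pC pD oC oD oQ fW); set A := [set z | _].
  have mA : measurable A by exact: measurable_wmap_cone.
  rewrite muleC -integral_indicT// -ge0_integralZl//; last 2 first.
  - exact/measurable_EFinP/measurable_indic.
  - by rewrite lee_fin.
  apply: eq_integral => z _; rewrite [X in _ * X * _ * _](_ : _ = 1); last first.
    by rewrite indicE mem_set.
  rewrite mule1 -muleA; congr (_ * _); rewrite -EFinM; congr (_%:E); rewrite !indicE -natrM mulnb.
  congr ((nat_of_bool _)%:R); apply/idP/andP; rewrite !inE.
    by case.
  by case.
split.
  rewrite GE; exact: (measurable_sine_integrand haar B1 B2 mf f0 mK1 mK2).
rewrite GE; apply: (etrans (sine_integral haar gB1 gB2 ijd mf f0 mK1 mK2 cK1 cK2 K10 K20)).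
rewrite cij_sine -(sine_law mf f0 gB1 gB2) (cvol_coord pC oC) (cvol_coord pD oD).
by rewrite muleA muleC muleA.
Qed.

End RotationSum.

(** * From nonnegative to bounded f *)

Theorem theorem4p2 (R : realType) (d i j k : nat)
    (dT : measure_display) (T : measurableType dT)
    (P : probability T R) (rot : T -> 'M[R]_d)
    (C D : set 'rV[R]_d) (f : R -> R) :
  (2 <= d)%N ->
  haar_rotation P rot ->
  polyhedral_cone C -> polyhedral_cone D ->
  dim_is C i -> dim_is D j ->
  (0 < k)%N -> (i + j + k)%N = d ->
  measurable_fun `[(0:R), 1] f ->
  (exists M : R, forall x, x \in `[(0:R), 1] -> `|f x| <= M) ->
  (\int[P]_t (cvol (d - k)%N (minksum C (rot_set (rot t) D))
               * (f (gsineC C (rot_set (rot t) D)))%:E)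
   = cij P rot i j f * cvol i C * cvol j D)%E.
Proof.
move=> _ haar pC pD [B1 oC] [B2 oD] k0 dE mf [M fM].
have ijd : (i + j < d)%N by rewrite -dE -[X in (X < _)%N]addn0 ltn_add2l.
have dk : (d - k = i + j)%N by rewrite -dE addnK.
rewrite dk.
have M0 : 0 <= M by apply: le_trans (fM 0 _); rewrite ?normr_ge0// in_itv/= lexx ler01.
(* f is known to be measurable and bounded on [0, 1] only; extension by 0 loses nothing, since all
   sines lie in that interval. *)
pose fp := f \_ `[(0:R), 1].
have fpE x : 0 <= x <= 1 -> fp x = f x.
  by move=> x01; rewrite /fp patchE mem_set//= in_itv.
have mfp : measurable_fun setT fp by apply/(measurable_restrictT _ _).1.
have fpM x : `|fp x| <= M.
  rewrite /fp patchE; case: ifPn => [|_]; last by rewrite normr0.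
  by rewrite inE; exact: fM.
(* On [0, 1] f is the difference of these two nonnegative functions, and [rotation_sum_ge0] applies
   to each. *)
pose f1 x := fp x + M; pose f2 (x : R) := M.
have f10 x : 0 <= f1 x by rewrite /f1 -lerBlDr sub0r; have /ler_normlP[] := fpM x; lra.
have mf1 : measurable_fun setT f1 by exact: measurable_funD.
have mf2 : measurable_fun setT f2 by exact: measurable_cst.
pose A t := cvol (i + j) (minksum C (rot_set (rot t) D)).
pose s t := gsineC C (rot_set (rot t) D).
have id' : (i <= d)%N by rewrite (leq_trans _ (ltnW ijd))// leq_addr.
have jd' : (j <= d)%N by rewrite (leq_trans _ (ltnW ijd))// leq_addl.
pose s' t := gsineC (coord_sub (R := R) (d := d) i) (rot_set (rot t) (coord_sub j)).
have s01 t : 0 <= s t <= 1.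
  by rewrite /s (gsineC_rot haar ijd oC oD); exact: (sine_of_bounds haar oC oD).
have s'E t : s' t = sine_of (pid_mx i : 'M[R]_(i, d)) (pid_mx j : 'M[R]_(j, d)) (rot t).
  by rewrite /s' (gsineC_rot haar ijd (onb_coord id') (onb_coord jd')).
have s'01 t : 0 <= s' t <= 1.
  by rewrite s'E; exact: (sine_of_bounds haar (onb_coord id') (onb_coord jd')).
have ms' : measurable_fun setT s'.
  rewrite (_ : s' = fun t => sine_of (pid_mx i : 'M[R]_(i, d)) (pid_mx j : 'M[R]_(j, d)) (rot t)).
    exact: (measurableT_comp (measurable_sine (pid_mx i) (pid_mx j)) (measurable_rot haar)).
  by apply/funext.
(* The conic volume lies between 0 and 1, so both integrands are real-valued and bounded, and the
   integrals may be subtracted. *)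
pose a t := fine (A t).
have AE t : A t = (a t)%:E.
  have /andP[A0 A1] := cvol_rot_bounds haar pC pD oC oD t.
  by rewrite /a fineK// ge0_fin_numE// (le_lt_trans A1)// ltry.
have a01 t : 0 <= a t <= 1.
  by have := cvol_rot_bounds haar pC pD oC oD t; rewrite -/(A t) AE !lee_fin.
have bnd1 x : `|f1 x| <= M + M.
  rewrite /f1; apply: le_trans (ler_normD _ _) _; apply: lerD => //.
  by rewrite ger0_norm.
have bnd2 x : `|f2 x| <= M + M by rewrite /f2 ger0_norm// lerDl.
have intb (g : T -> R) : measurable_fun setT (EFin \o g) ->
    (forall t, `|g t| <= M + M) -> P.-integrable setT (EFin \o g).
  move=> mg gM; apply: (@le_integrable _ _ _ P setT _ _ (cst (M + M)%:E)) => //.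
    move=> t _ /=; rewrite lee_fin (le_trans (gM t))// ger0_norm// addr_ge0//.
  exact: finite_measure_integrable_cst.
have aM t (h : R -> R) : (forall x, `|h x| <= M + M) -> `|a t * h (s t)| <= M + M.
  move=> hM; have /andP[a0 a1] := a01 t; rewrite normrM ger0_norm//.
  by apply: le_trans (hM (s t)); rewrite ler_piMl.
have [m1 I1] := rotation_sum_ge0 haar ijd pC pD oC oD mf1 f10.
have [m2 I2] := rotation_sum_ge0 haar ijd pC pD oC oD mf2 (fun=> M0).
have E1 : (fun t => A t * (f1 (s t))%:E)%E = EFin \o (fun t => a t * f1 (s t)).
  by apply/funext => t; rewrite AE.
have E2 : (fun t => A t * (f2 (s t))%:E)%E = EFin \o (fun t => a t * f2 (s t)).
  by apply/funext => t; rewrite AE.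
have i1 : P.-integrable setT (EFin \o (fun t => a t * f1 (s t))).
  by apply: intb => [|t]; [rewrite -E1|exact: aM].
have i2 : P.-integrable setT (EFin \o (fun t => a t * f2 (s t))).
  by apply: intb => [|t]; [rewrite -E2|exact: aM].
have c1 : P.-integrable setT (EFin \o (fun t => f1 (s' t))).
  by apply: intb => // ; apply/measurable_EFinP; exact: (measurableT_comp mf1 ms').
have c2 : P.-integrable setT (EFin \o (fun t => f2 (s' t))).
  by apply: intb => [|t]; [apply/measurable_EFinP; exact: (measurableT_comp mf2 ms')|exact: bnd2].
have cijE : cij P rot i j f = (cij P rot i j f1 - cij P rot i j f2)%E.
  rewrite /cij -[RHS](integralB measurableT c1 c2).
  apply: eq_integral => t _ /=; rewrite -EFinB; congr (_%:E).
  by rewrite /f1 /f2 -/(s' t) fpE// addrK.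
have LE : (\int[P]_t (A t * (f (s t))%:E) =
    \int[P]_t (A t * (f1 (s t))%:E) - \int[P]_t (A t * (f2 (s t))%:E))%E.
  rewrite E1 E2 -(integralB measurableT i1 i2); apply: eq_integral => t _ /=.
  by rewrite AE -EFinM -EFinB; congr (_%:E); rewrite /f1 /f2 fpE//; ring.
apply: (etrans LE); rewrite I1 I2 cijE.
have n1 : cij P rot i j f1 \is a fin_num by exact: (integrable_fin_num measurableT c1).
have n2 : cij P rot i j f2 \is a fin_num by exact: (integrable_fin_num measurableT c2).
have nC : cvol i C \is a fin_num.
  rewrite (cvol_coord pC oC) fin_num_measure//.
  by apply: polyhedral_measurable => //; exact: measurable_mulmxr.
have nD : cvol j D \is a fin_num.
  rewrite (cvol_coord pD oD) fin_num_measure//.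
  by apply: polyhedral_measurable => //; exact: measurable_mulmxr.
(* All factors are finite, so distributivity remains to be checked between real numbers only. *)
move: (cij P rot i j f1) (cij P rot i j f2) (cvol i C) (cvol j D) n1 n2 nC nD.
move=> [r1||] [r2||] [v||] [w||] //= _ _ _ _.
by congr (_%:E); ring.
Qed.
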